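(* Let $0<p\le1$ and $G_n=G(n,p)$, $n\ge1$, independent Erdős–Rényi random graphs. For $\mu>0$ let $\sigma_n^\mu$ be the chip configuration on $G_n$ in which each vertex $v$ independently receives a random number of chips with $P(\sigma^\mu_n(v)=k)=(\mu n)^k/(1+\mu n)^{k+1}$, $k\ge0$ (mean $\mu n$), all chosen independently over $n$, and coupled over $\mu$ as follows: each vertex $v$ carries an independent sequence of independent uniform $[0,1]$ random variables, and $\sigma_n^\mu(v)=k$ iff the first $k$ of them lie in $(\frac1{1+\mu n},1]$ and the $(k+1)$-th lies in $[0,\frac1{1+\mu n}]$. Then with probability one, the functions $\mu\mapsto a(G_n,\sigma_n^\mu)$ converge pointwise to a Devil's staircase on the interval $[0,\frac{p}{\log 2}]$.
   Context: For a finite graph $G$, a chip configuration is $\sigma:V(G)\to\mathbb{R}_{\ge0}$; in one parallel step each vertex $v$ fires $\lfloor\sigma(v)/\deg_G(v)\rfloor$ times (sending one chip along each incident edge per firing), and $u_n(v)$ is the number of firings of $v$ in the first $n$ steps; for connected $G$ the activity $a(G,\sigma)=\lim_n u_n(v)/n$ exists and does not depend on $v$ (almost surely $G_n$ is connected for all large $n$). $\log$ is the natural logarithm. A Devil's staircase on $[a,b]$ is a continuous nondecreasing function $c:[a,b]\to[0,1]$ with $c(a)=0$, $c(b)=1$ which is locally constant on an open dense set. *)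

(* Defs.v *)
From HB Require Import structures.
From mathcomp Require Import all_boot all_order all_algebra.
From mathcomp Require Import all_classical all_reals all_analysis.

Set Implicit Arguments.
Unset Strict Implicit.
Unset Printing Implicit Defensive.

Import Order.TTheory GRing.Theory Num.Theory.
Import numFieldNormedType.Exports.

Local Open Scope classical_set_scope.
Local Open Scope ring_scope.

Section ChipFiring.
Context {R : realType} {V : finType}.
Implicit Types (e : rel V) (sigma : V -> R) (v : V).

Definition simple_graph e : Prop := symmetric e /\ irreflexive e.

Definition degree e v : nat := #|[pred w | e v w]|.

(* [Num.truncn] is the floor on nonnegative reals; an isolated vertex never
   fires, because [x / 0 = 0]. *)
Definition firings e sigma v : nat := Num.truncn (sigma v / (degree e v)%:R).

Definition parallel_step e sigma : V -> R := fun v =>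
  sigma v - (firings e sigma v * degree e v)%N%:R
  + (\sum_(w | e v w) firings e sigma w)%N%:R.

Definition odometer e sigma (n : nat) v : nat :=
  (\sum_(t < n) firings e (iter t (parallel_step e) sigma) v)%N.

Definition is_activity e sigma (a : R) : Prop :=
  forall v, (odometer e sigma n v)%:R / n%:R @[n --> \oo] --> a.

(* The junk value -1, used when the vertices have no common limit (which can
   only happen on a disconnected graph), is not an activity: if [V] is nonempty,
   activities are nonnegative.  Hence a sequence [activity (e n) (sigma n)] with a
   nonnegative limit is made of actual activities from some rank on. *)
Definition activity e sigma : R := xget (-1) (is_activity e sigma).

End ChipFiring.

(* [c] is only meaningful on [a, b].  The relatively open subsets of [a, b] are
   the sets [D `&` `[a, b]] with [D] open in [R]. *)
Definition devils_staircase {R : realType} (a b : R) (c : R -> R) : Prop :=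
  [/\ {within `[a, b], continuous c},
      {in `[a, b] &, {homo c : x y / x <= y}},
      {in `[a, b], forall x, 0 <= c x <= 1},
      c a = 0 /\ c b = 1 &
      exists D : set R,
        [/\ open D,
            `[a, b] `<=` closure (D `&` `[a, b]) &
            forall x, (D `&` `[a, b]) x ->
              \forall y \near x, y \in `[a, b] -> c y = c x]].

Section Randomness.
Context {R : realType} {d : measure_display} {Omega : measurableType d}
  (P : probability Omega R).

Definition mutually_independent (I : eqType) (F : I -> set (set Omega)) : Prop :=
  forall (s : seq I) (A : I -> set Omega), uniq s ->
    (forall i, i \in s -> F i (A i)) ->
    P (\bigcap_(i in [set` s]) A i) = (\prod_(i <- s) P (A i))%E.

(* G(n, p): the edges ij with i < j are independent events of probability p. *)
Definition erdos_renyi (n : nat) (p : R) (G : Omega -> rel 'I_n) : Prop :=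
  [/\ forall w, simple_graph (G w),
      forall i j : 'I_n, (i < j)%N ->
        measurable [set w | G w i j] /\ P [set w | G w i j] = p%:E &
      mutually_independent
        (fun ij : {ij : 'I_n * 'I_n | (ij.1 < ij.2)%N} =>
           [set [set w | G w (val ij).1 (val ij).2]])].

Definition uniform01 (X : {RV P >-> R}) : Prop :=
  forall B, measurable B ->
    distribution P X B = uniform_prob (@ltr01 R) B.

(* The sources of randomness are the graphs [G n], indexed by [inl n], and the
   variables [U n v k], indexed by [inr (n, v, k)]; each one contributes the
   events it generates. *)
Definition source_events (G : forall n, Omega -> rel 'I_n)
    (U : forall n, 'I_n -> nat -> {RV P >-> R})
    (i : nat + {n : nat & ('I_n * nat)%type}) : set (set Omega) :=
  match i with
  | inl n => [set [set w | Q (G n w)] | Q in [set: set (rel 'I_n)]]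
  | inr (existT n (v, k)) =>
      [set U n v k @^-1` B | B in [set B : set R | measurable B]]
  end.

End Randomness.

Section Configuration.
Context {R : realType}.

(* [u] is the sequence of uniform variables carried by a vertex.  The default
   value 0 is used only when no such [k] exists, which has probability 0 if [u]
   is a sequence of independent uniform variables. *)
Definition geometric_chips (n : nat) (mu : R) (u : nat -> R) : nat :=
  let t := (1 + mu * n%:R)^-1 in
  xget 0%N [set k : nat | (forall i, (i < k)%N -> u i \in `]t, 1]) /\
                          u k \in `[0, t]].

Definition chip_configuration (n : nat) (mu : R) (u : 'I_n -> nat -> R) :
    'I_n -> R :=
  fun v => (geometric_chips n mu (u v))%:R.

End Configuration.

(* Main.v *)
Require Import Defs.
From HB Require Import structures.
From mathcomp Require Import all_boot all_order all_algebra.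
From mathcomp Require Import all_classical all_reals all_analysis.
From mathcomp Require Import zify lra.
Import Order.TTheory GRing.Theory Num.Theory.
Import numFieldNormedType.Exports.
Local Open Scope classical_set_scope.
Local Open Scope ring_scope.

(** The odometer satisfies [u_(t+1)(v) = floor (sigma v / deg v + r_t(v))], where
    [r_t(v)] is the average of [u_t] over the neighbours of [v].  If, for every [v]
    and [r], the average of [floor (sigma w / deg w + r)] over the neighbours [w] of
    [v] is at most [F r], with [F] nondecreasing and [F (r + 1) = F r + 1], then
    [r_t(v) <= F^t(0)] for all [v] by monotonicity, and the activity is at most the
    rotation number of [F]; likewise for lower bounds.  On [G(n, p)] the law of
    [sigma w / deg w] is close to the exponential law of rate [b = p / mu], for
    which this average is [expo_map b r], that is [e^(b r) / (e^b - 1)] on [[0, 1]].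
    Exponential concentration (Chernoff) and Borel-Cantelli make the bounds hold,
    for all vertices at once, with [F = expo_map b'] for any [b'] on the
    appropriate side of [b].  This gives the almost sure convergence for one [mu],
    hence for all rational [mu], and then for all [mu] because the activity is
    nondecreasing in [mu] and the limit is continuous.

    Hence the limit is [mu |-> rotation number of expo_map (p / mu)], which is
    continuous and monotone.  If it took a rational value [k / q] at a single
    parameter, the [q]-th iterate of the map would be the translation by [k]; this
    is impossible, because the map is strictly convex between its break points,
    which are the integers.  So it is locally constant on a dense open set.  At
    [b = ln 2] the map sends 0 to 1, so that the rotation number is 1. *)

Set Implicit Arguments.
Unset Strict Implicit.
Unset Printing Implicit Defensive.

Lemma truncnDr_nat {R : archiNumDomainType} (x : R) k : 0 <= x ->
  Num.truncn (x + k%:R) = (Num.truncn x + k)%N.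
Proof. by move=> x0; rewrite addrC truncnD ?natr_nat// natrK addnC. Qed.

(** * Rotation numbers *)

Section LinearGrowth.
Context {R : realType}.
Implicit Types (x y : nat -> R) (l C : R).

Definition quasi_additive x C := forall s t, `|x (s + t)%N - x s - x t| <= C.

Definition bounded_deviation x l C := forall t, `|x t - t%:R * l| <= C.

Lemma natmul_bounded_le0 (a b : R) : (forall j : nat, j%:R * a <= b) -> a <= 0.
Proof.
move=> jab; rewrite leNgt; apply/negP => a0.
have := jab (Num.truncn (b / a)).+1.
by rewrite leNgt -ltr_pdivrMr// truncnS_gt.
Qed.

Lemma bounded_deviation_le x y l l' C C' D :
  bounded_deviation x l C -> bounded_deviation y l' C' ->
  (forall t, x t <= y t + D) -> l <= l'.
Proof.
move=> xl yl' xy; rewrite -subr_le0; apply: (@natmul_bounded_le0 _ (C + C' + D)) => j.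
have := xl j; have := yl' j; have := xy j; rewrite !ler_norml; lra.
Qed.

Lemma bounded_deviation_cvg x l C :
  bounded_deviation x l C -> x t / t%:R @[t --> \oo] --> l.
Proof.
move=> xl; apply/cvgrPdist_le => e e0; near=> t.
have t0 : (0 : R) < t%:R by near: t; exact: nbhs_infty_gtr.
have -> : l - x t / t%:R = - ((x t - t%:R * l) / t%:R).
  by rewrite mulrBl mulrAC divff ?gt_eqF// mul1r opprB.
rewrite normrN normrM normfV (ger0_norm (ltW t0)) ler_pdivrMr//.
rewrite (le_trans (xl t))// -ler_pdivrMl//.
by near: t; exact: nbhs_infty_ger.
Unshelve. all: by end_near.
Qed.

Lemma bounded_deviation_succ x l C :
  bounded_deviation x l C -> bounded_deviation (fun t => x t.+1) l (C + `|l|).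
Proof.
move=> xl t; have -> : x t.+1 - t%:R * l = (x t.+1 - t.+1%:R * l) + l.
  by rewrite -natr1; lra.
by apply: le_trans (ler_normD _ _) _; rewrite lerD2r.
Qed.

Lemma bounded_deviation_dist x y l l' C C' t : (0 < t)%N ->
  bounded_deviation x l C -> bounded_deviation y l' C' ->
  `|l - l'| <= (C + C' + `|x t - y t|) / t%:R.
Proof.
move=> t0 xl yl'; have tR0 : (0 : R) < t%:R by rewrite ltr0n.
rewrite ler_pdivlMr// -[X in _ * X](ger0_norm (ltW tR0)) -normrM mulrC mulrBr.
by have := xl t; have := yl' t; have := lexx `|x t - y t|; rewrite !ler_norml; lra.
Qed.

Lemma quasi_additive_multiple x C : quasi_additive x C ->
  forall t k, `|x (k * t)%N - k%:R * x t| <= k.+1%:R * C.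
Proof.
move=> qx t; elim=> [|k IH].
  by have := qx 0 0; rewrite add0n mul0n mul0r subr0 subrr sub0r normrN mul1r.
rewrite mulSn.
have -> : x (t + k * t)%N - k.+1%:R * x t =
    (x (t + k * t)%N - x t - x (k * t)%N) + (x (k * t)%N - k%:R * x t).
  by rewrite -natr1; lra.
rewrite (le_trans (ler_normD _ _))// -[in leRHS]natr1 mulrDl mul1r addrC.
exact: lerD.
Qed.

(* Compare [x (s * t)] with [s * x t] and with [t * x s]. *)
Lemma quasi_additive_ratio_le x C s t : quasi_additive x C ->
  (0 < s)%N -> (0 < t)%N -> (x t - C) / t%:R <= (x s + C) / s%:R.
Proof.
move=> qx s0 t0.
rewrite ler_pdivrMr ?ltr0n// mulrAC ler_pdivlMr ?ltr0n//.
rewrite -subr_le0; apply: (@natmul_bounded_le0 _ (2 * C)) => j.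
have /ler_normlP[_] := quasi_additive_multiple qx s (j * t)%N.
have /ler_normlP[+ _] := quasi_additive_multiple qx t (j * s)%N.
rewrite (_ : j * t * s = j * s * t)%N; last by rewrite -!mulnA (mulnC t).
rewrite -![_.+1%:R]natr1 !natrM; lra.
Qed.

Lemma quasi_additive_slope x C :
  quasi_additive x C -> exists l, bounded_deviation x l C.
Proof.
move=> qx; pose A := [set (x t - C) / t%:R | t in [set t | (0 < t)%N]].
have supA : has_sup A.
  split; first by exists ((x 1%N - C) / 1%:R); exists 1%N.
  by exists ((x 1%N + C) / 1%:R) => _ [t t0 <-]; exact: quasi_additive_ratio_le.
exists (sup A) => -[|t].
  by have := qx 0 0; rewrite add0n mul0r subr0 subrr sub0r normrN.
rewrite ler_norml; apply/andP; split.
- have : sup A <= (x t.+1 + C) / t.+1%:R.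
    apply: ge_sup => [|_ [s s0 <-]]; first by case: supA.
    exact: quasi_additive_ratio_le.
  by rewrite ler_pdivlMr//; lra.
- have : (x t.+1 - C) / t.+1%:R <= sup A.
    by apply: sup_upper_bound => //; exists t.+1.
  by rewrite ler_pdivrMr//; lra.
Qed.

End LinearGrowth.

Section RotationNumber.
Context {R : realType}.
Implicit Types (F G : R -> R) (x y : R).

Definition circle_lift F := [/\ 0 <= F 0,
  forall x y, 0 <= x -> x <= y -> F x <= F y &
  forall x, 0 <= x -> F (x + 1) = F x + 1].

Definition rotation_number F : R := lim (iter t F 0 / t%:R @[t --> \oo]).

Lemma subr_truncn_itv x : 0 <= x -> 0 <= x - (Num.truncn x)%:R < 1.
Proof. by move=> /truncn_itv; rewrite -natr1 => /andP[? ?]; apply/andP; split; lra. Qed.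

Lemma circle_lift_ge0 F x : circle_lift F -> 0 <= x -> 0 <= F x.
Proof. by case=> F0 Fm _ x0; exact: le_trans F0 (Fm _ _ _ x0). Qed.

Lemma circle_liftD_nat F x k : circle_lift F -> 0 <= x -> F (x + k%:R) = F x + k%:R.
Proof.
move=> liftF x0; elim: k => [|k IH]; first by rewrite !addr0.
by rewrite -natr1 !addrA -IH; case: liftF => _ _ ->//; exact: addr_ge0.
Qed.

Lemma circle_lift_le_itv01 F G : circle_lift F -> circle_lift G ->
  (forall x, 0 <= x < 1 -> F x <= G x) -> forall x, 0 <= x -> F x <= G x.
Proof.
move=> liftF liftG FG x x0; have x01 := subr_truncn_itv x0; have /andP[fx0 _] := x01.
by rewrite -[x](subrK (Num.truncn x)%:R) !circle_liftD_nat// lerD2r FG.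
Qed.

Lemma iter_lift_ge0 F x t : circle_lift F -> 0 <= x -> 0 <= iter t F x.
Proof. by move=> liftF x0; elim: t => //= t; exact: circle_lift_ge0. Qed.

Lemma iter_lift_homo F x y t : circle_lift F -> 0 <= x -> x <= y ->
  iter t F x <= iter t F y.
Proof.
move=> liftF x0 xy; elim: t => //= t IH; case: (liftF) => _ + _; apply=> //.
exact: iter_lift_ge0.
Qed.

Lemma iter_liftD_nat F x t k : circle_lift F -> 0 <= x ->
  iter t F (x + k%:R) = iter t F x + k%:R.
Proof.
by move=> liftF x0; elim: t => //= t ->; rewrite circle_liftD_nat//; exact: iter_lift_ge0.
Qed.

Lemma iter_lift_le F G x t : circle_lift F -> circle_lift G ->
  (forall x, 0 <= x -> F x <= G x) -> 0 <= x -> iter t F x <= iter t G x.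
Proof.
move=> liftF liftG FG x0; elim: t => //= t IH.
have itF0 := iter_lift_ge0 t liftF x0.
by apply: le_trans (FG _ itF0) _; case: liftG => _ + _; apply.
Qed.

Lemma iter_lift_quasi_additive F : circle_lift F ->
  quasi_additive (fun t => iter t F 0) 1.
Proof.
move=> liftF s t; rewrite addnC iterD; set y := iter s F 0.
have y0 : 0 <= y by exact: iter_lift_ge0.
have /andP[ky yk] := truncn_itv y0.
have := iter_lift_homo t liftF (ler0n _ _) ky.
have := iter_lift_homo t liftF y0 (ltW yk).
move: yk; rewrite -[_.+1%:R]add0r -[(Num.truncn y)%:R]add0r !iter_liftD_nat//.
by rewrite -natr1 ler_norml; lra.
Qed.

Lemma rotation_number_deviation F : circle_lift F ->
  bounded_deviation (fun t => iter t F 0) (rotation_number F) 1.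
Proof.
move=> /iter_lift_quasi_additive/quasi_additive_slope[l Fl].
by rewrite /rotation_number (cvg_lim _ (bounded_deviation_cvg Fl)).
Qed.

Lemma rotation_number_le F G : circle_lift F -> circle_lift G ->
  (forall x, 0 <= x -> F x <= G x) -> rotation_number F <= rotation_number G.
Proof.
move=> liftF liftG FG.
apply: (bounded_deviation_le (rotation_number_deviation liftF)
  (rotation_number_deviation liftG) (D := 0)) => t.
by rewrite addr0; exact: iter_lift_le.
Qed.

Lemma rotation_number_deviation_mul F q : circle_lift F ->
  bounded_deviation (fun j => iter (j * q) F 0) (q%:R * rotation_number F) 1.
Proof. by move=> liftF j; rewrite mulrA -natrM; exact: rotation_number_deviation. Qed.

Lemma iter_mul_ge F x q k j : circle_lift F -> 0 <= x ->
  x + k%:R <= iter q F x -> x + (j * k)%:R <= iter (j * q) F x.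
Proof.
move=> liftF x0 xk; elim: j => [|j IH]; first by rewrite addr0.
rewrite !mulSn natrD iterD.
have := iter_lift_homo q liftF (addr_ge0 x0 (ler0n _ (j * k))) IH.
by rewrite iter_liftD_nat//; lra.
Qed.

Lemma iter_mul_le F x q k j : circle_lift F -> 0 <= x ->
  iter q F x <= x + k%:R -> iter (j * q) F x <= x + (j * k)%:R.
Proof.
move=> liftF x0 xk; elim: j => [|j IH]; first by rewrite addr0.
rewrite !mulSn natrD iterD.
have := iter_lift_homo q liftF (iter_lift_ge0 _ liftF x0) IH.
by rewrite iter_liftD_nat//; lra.
Qed.

Lemma bounded_deviation_natmul k : @bounded_deviation R (fun j => (j * k)%:R) k%:R 0.
Proof. by move=> j; rewrite natrM subrr normr0. Qed.

Lemma rotation_number_ge_ratio F x q k : circle_lift F -> 0 <= x -> (0 < q)%N ->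
  x + k%:R <= iter q F x -> k%:R / q%:R <= rotation_number F.
Proof.
move=> liftF x0 q0 xk; rewrite ler_pdivrMr ?ltr0n// mulrC.
set K := (Num.truncn x).+1.
apply: (bounded_deviation_le (bounded_deviation_natmul k)
  (rotation_number_deviation_mul q liftF) (D := K%:R)) => j.
have xK : x <= 0 + K%:R by rewrite add0r ltW// truncnS_gt.
have := iter_lift_homo (j * q) liftF x0 xK; rewrite iter_liftD_nat//.
have := iter_mul_ge j liftF x0 xk; lra.
Qed.

Lemma rotation_number_le_ratio F x q k : circle_lift F -> 0 <= x -> (0 < q)%N ->
  iter q F x <= x + k%:R -> rotation_number F <= k%:R / q%:R.
Proof.
move=> liftF x0 q0 xk; rewrite ler_pdivlMr ?ltr0n// mulrC.
apply: (bounded_deviation_le (rotation_number_deviation_mul q liftF)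
  (bounded_deviation_natmul k) (D := x)) => j.
have := iter_lift_homo (j * q) liftF (lexx 0) x0.
have := iter_mul_le j liftF x0 xk; lra.
Qed.

End RotationNumber.

(** * The exponential family of circle maps *)

Section ExponentialBranch.
Context {R : realType}.
Implicit Types b y z : R.

Definition expo_branch b y : R := expR (b * y) / (expR b - 1).

Lemma expRB1_gt0 b : 0 < b -> 0 < expR b - 1.
Proof. by move=> b0; rewrite subr_gt0 expR_gt1. Qed.

Lemma expo_branch_gt0 b y : 0 < b -> 0 < expo_branch b y.
Proof. by move=> b0; rewrite divr_gt0 ?expR_gt0 ?expRB1_gt0. Qed.

Lemma expo_branchD b y z : expo_branch b (y + z) = expR (b * z) * expo_branch b y.
Proof. by rewrite /expo_branch mulrDr expRD mulrA (mulrC (expR (b * z))). Qed.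

Lemma expo_branch1 b : 0 < b -> expo_branch b 1 = expo_branch b 0 + 1.
Proof.
move=> /expRB1_gt0 b0; rewrite /expo_branch mulr0 expR0 mulr1.
by rewrite -[X in _ = _ + X](@divff _ (expR b - 1)) ?gt_eqF// -mulrDl subrKC.
Qed.

Lemma expo_branch_lt b y z : 0 < b -> y < z -> expo_branch b y < expo_branch b z.
Proof. by move=> b0 yz; rewrite ltr_pM2r ?invr_gt0 ?expRB1_gt0// ltr_expR ltr_pM2l. Qed.

Lemma expo_branch_le b y z : 0 < b -> y <= z -> expo_branch b y <= expo_branch b z.
Proof. by move=> b0; rewrite le_eqVlt => /predU1P[->//|/(expo_branch_lt b0)/ltW]. Qed.

(* In this form the denominator is visibly increasing in [b]. *)
Lemma expo_branchE b y :
  expo_branch b y = (expR (b * (1 - y)) - expR (- (b * y)))^-1.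
Proof.
rewrite /expo_branch -[expR (b * y)]invrK -expRN -invfM; congr (_^-1).
by rewrite mulrBr mulr1 -expRD mulrBr mulr1 (addrC (- _)).
Qed.

Lemma expo_branch_antitone b b' y : 0 < b -> b <= b' -> 0 <= y <= 1 ->
  expo_branch b' y <= expo_branch b y.
Proof.
move=> b0 bb' /andP[y0 y1].
have := expo_branch_gt0 y b0; have := expo_branch_gt0 y (lt_le_trans b0 bb').
rewrite !expo_branchE !invr_gt0 => d' d; rewrite lef_pV2 ?posrE//.
apply: lerB; rewrite ler_expR.
  by rewrite ler_wpM2r// subr_ge0.
by rewrite lerN2 ler_wpM2r.
Qed.

Lemma expo_branch_cvg b y : 0 < b ->
  expo_branch b' y @[b' --> b] --> expo_branch b y.
Proof.
move=> b0; apply: cvgM.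
  apply: continuous_cvg; first exact: continuous_expR.
  by apply: cvgM; [exact: cvg_id|exact: cvg_cst].
apply: cvgV; first by rewrite gt_eqF// expRB1_gt0.
by apply: cvgB; [exact: continuous_expR|exact: cvg_cst].
Qed.

Lemma expo_branch_param b b' y : 0 < b -> b <= b' -> 0 <= y <= 1 ->
  expo_branch b y - expo_branch b' y <= expR b * (expo_branch b 0 - expo_branch b' 0).
Proof.
move=> b0 bb' /andP[y0 y1]; have b'0 : 0 < b' by exact: lt_le_trans bb'.
have branch0B : 0 <= expo_branch b 0 - expo_branch b' 0.
  by rewrite subr_ge0 expo_branch_antitone// lexx ler01.
apply: (@le_trans _ _ (expR (b * y) * (expo_branch b 0 - expo_branch b' 0))).
  rewrite -{1 2}[y]add0r !expo_branchD mulrBr lerB// ler_pM2r ?expo_branch_gt0//.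
  by rewrite ler_expR ler_wpM2r.
by rewrite ler_wpM2r// ler_expR ger_pMr.
Qed.

Definition expo_lip b : R := b * expo_branch b 1.

Lemma expo_lip_gt0 b : 0 < b -> 0 < expo_lip b.
Proof. by move=> b0; rewrite mulr_gt0// expo_branch_gt0. Qed.

Lemma expo_branch_lipschitz b y z : 0 < b -> y <= z -> z <= 1 ->
  expo_branch b z - expo_branch b y <= expo_lip b * (z - y).
Proof.
move=> b0 yz z1; have -> : y = z + (y - z) by lra.
rewrite expo_branchD -[X in X - _]mul1r -mulrBl.
have chord : 1 - expR (b * (y - z)) <= b * (z - y).
  by have := expR_ge1Dx (b * (y - z)); lra.
apply: (@le_trans _ _ (b * (z - y) * expo_branch b z)).
  by rewrite ler_wpM2r// ltW// expo_branch_gt0.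
have -> : z - (z + (y - z)) = z - y by lra.
rewrite /expo_lip [leRHS]mulrAC ler_wpM2l//; last exact: expo_branch_le.
by rewrite mulr_ge0 ?subr_ge0// ltW.
Qed.

(* The ratio of the branches is largest at [y = 1], where it is less than 1. *)
Lemma expo_branch_ratio b b' : 0 < b -> b < b' ->
  exists2 c : R, 0 < c < 1 & forall y, y <= 1 -> expo_branch b' y <= c * expo_branch b y.
Proof.
move=> b0 bb'; have b'0 : 0 < b' by exact: lt_trans bb'.
exists (expo_branch b' 1 / expo_branch b 1).
  rewrite divr_gt0 ?expo_branch_gt0//= ltr_pdivrMr ?expo_branch_gt0// mul1r.
  rewrite !expo_branchE !subrr !mulr0 !mulr1 expR0 ltf_pV2 ?posrE.
  - by rewrite ltrD2l ltrN2 ltr_expR ltrN2.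
  - by rewrite subr_gt0 expR_lt1 oppr_lt0.
  - by rewrite subr_gt0 expR_lt1 oppr_lt0.
move=> y y1; have -> : y = 1 + (y - 1) by lra.
rewrite !expo_branchD [leRHS]mulrCA divfK ?gt_eqF ?expo_branch_gt0//.
by rewrite ler_pM2r ?expo_branch_gt0// ler_expR ler_wnM2r ?subr_le0// ltW.
Qed.

End ExponentialBranch.

Section ExponentialCircleMap.
Context {R : realType}.
Implicit Types b x y : R.

Definition expo_map b x : R :=
  (Num.truncn x)%:R + expo_branch b (x - (Num.truncn x)%:R).

Lemma expo_mapE b x n : 0 < b -> n%:R <= x <= n.+1%:R ->
  expo_map b x = n%:R + expo_branch b (x - n%:R).
Proof.
move=> b0 /andP[nx]; rewrite le_eqVlt => /predU1P[->|xn].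
  rewrite /expo_map natrK subrr -natr1 (addrC _ 1) addrK expo_branch1//.
  lra.
by rewrite /expo_map (@truncn_def _ x n)// nx.
Qed.

Lemma expo_map_branch b y : 0 < b -> 0 <= y <= 1 -> expo_map b y = expo_branch b y.
Proof. by move=> b0 y01; rewrite (@expo_mapE _ _ 0)// ?subr0 ?add0r. Qed.

Lemma expo_map_lt b x y : 0 < b -> 0 <= x -> x < y -> expo_map b x < expo_map b y.
Proof.
move=> b0 x0 xy; have y0 : 0 <= y by exact: le_trans x0 (ltW xy).
have /andP[_ x1] := subr_truncn_itv x0; have /andP[fy0 _] := subr_truncn_itv y0.
rewrite /expo_map.
have := le_truncn (ltW xy); rewrite leq_eqVlt => /predU1P[->|xy_int].
  by rewrite ltrD2l expo_branch_lt// ltrD2r.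
have := expo_branch_lt b0 x1; have := expo_branch_le b0 fy0.
have : (Num.truncn x).+1%:R <= (Num.truncn y)%:R :> R by rewrite ler_nat.
by rewrite expo_branch1// -natr1; lra.
Qed.

Lemma expo_map_le b x y : 0 < b -> 0 <= x -> x <= y -> expo_map b x <= expo_map b y.
Proof. by move=> b0 x0; rewrite le_eqVlt => /predU1P[->//|/(expo_map_lt b0 x0)/ltW]. Qed.

Lemma expo_map_lift b : 0 < b -> circle_lift (expo_map b).
Proof.
move=> b0; split=> [|x y|x x0].
- by rewrite expo_map_branch ?lexx ?ler01// ltW// expo_branch_gt0.
- exact: expo_map_le.
- by rewrite /expo_map (truncnDr_nat 1)// natrD opprD addrACA subrr addr0 addrAC.
Qed.

Lemma expo_map_antitone b b' x : 0 < b -> b <= b' -> 0 <= x ->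
  expo_map b' x <= expo_map b x.
Proof.
move=> b0 bb' /subr_truncn_itv/andP[fx0 fx1].
by rewrite lerD2l expo_branch_antitone// fx0 ltW.
Qed.

Lemma expo_map_param b b' x : 0 < b -> 0 < b' -> 0 <= x ->
  `|expo_map b x - expo_map b' x| <= expR b * `|expo_branch b 0 - expo_branch b' 0|.
Proof.
move=> b0 b'0 x0; have /andP[fx0 /ltW fx1] := subr_truncn_itv x0.
have [bb'|/ltW b'b] := leP b b'.
  rewrite !ger0_norm ?subr_ge0 ?expo_map_antitone ?expo_branch_antitone ?lexx ?ler01//.
  by rewrite /expo_map opprD addrACA subrr add0r expo_branch_param// fx0.
rewrite distrC (distrC (expo_branch b 0)).
rewrite !ger0_norm ?subr_ge0 ?expo_map_antitone ?expo_branch_antitone ?lexx ?ler01//.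
rewrite /expo_map opprD addrACA subrr add0r.
apply: le_trans (expo_branch_param b'0 b'b _) _; first by rewrite fx0.
by rewrite ler_wpM2r ?ler_expR// subr_ge0 expo_branch_antitone// lexx ler01.
Qed.

Lemma expo_map_lipschitz b x y : 0 < b -> 0 <= x -> x <= y ->
  expo_map b y - expo_map b x <= expo_lip b * (y - x).
Proof.
move=> b0 x0 xy; have y0 : 0 <= y by exact: le_trans x0 xy.
have /andP[_ /ltW fx1] := subr_truncn_itv x0.
have /andP[fy0 /ltW fy1] := subr_truncn_itv y0.
have := le_truncn xy; rewrite leq_eqVlt /expo_map => /predU1P[xy_int|].
  have := expo_branch_lipschitz b0 (_ : x - (Num.truncn x)%:R <= _) fy1.
  by rewrite xy_int lerD2r => /(_ xy); lra.
rewrite -(ler_nat R) -natr1 => xy_int.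
have lip1 : 1 <= expo_lip b.
  by have := expo_branch_lipschitz b0 ler01 (lexx _); rewrite expo_branch1//; lra.
have gap0 : 0 <= (Num.truncn y)%:R - (Num.truncn x)%:R - 1 :> R by lra.
have := expo_branch_lipschitz b0 fx1 (lexx _); rewrite expo_branch1//.
have := expo_branch_lipschitz b0 fy0 fy1.
have := ler_wpM2r gap0 lip1; lra.
Qed.

Lemma expo_map_dist b x y : 0 < b -> 0 <= x -> 0 <= y ->
  `|expo_map b x - expo_map b y| <= expo_lip b * `|x - y|.
Proof.
move=> b0; wlog yx : x y / y <= x => [sym x0 y0|x0 y0].
  by have [/sym|/ltW/sym] := leP y x; [exact|rewrite distrC (distrC y); exact].
by rewrite !ger0_norm ?subr_ge0 ?expo_map_le// expo_map_lipschitz.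
Qed.

Lemma expo_map_iter_lipschitz b x t : 0 < b -> 0 <= x ->
  iter t (expo_map b) x <= iter t (expo_map b) 0 + expo_lip b ^+ t * x.
Proof.
move=> b0 x0; have lift_b := expo_map_lift b0.
elim: t => [|t IH] /=; first by rewrite expr0 mul1r add0r.
have iter0 := iter_lift_ge0 t lift_b (lexx 0).
have := expo_map_lipschitz b0 iter0 (iter_lift_homo t lift_b (lexx 0) x0).
rewrite exprS -mulrA.
have : expo_lip b * (iter t (expo_map b) x - iter t (expo_map b) 0) <=
    expo_lip b * (expo_lip b ^+ t * x) by rewrite ler_pM2l ?expo_lip_gt0//; lra.
lra.
Qed.

Lemma expo_map_iter_cvg b x t : 0 < b -> 0 <= x ->
  iter t (expo_map b') x @[b' --> b] --> iter t (expo_map b) x.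
Proof.
move=> b0 x0; elim: t => [|t IH] /=; first exact: cvg_cst.
set y := iter t (expo_map b) x; pose y' b' := iter t (expo_map b') x.
have y0 : 0 <= y by apply: iter_lift_ge0 => //; exact: expo_map_lift.
pose err b' := expo_lip b * `|y' b' - y| + expR b * `|expo_branch b 0 - expo_branch b' 0|.
have err_cvg : err b' @[b' --> b] -->
    expo_lip b * `|y - y| + expR b * `|expo_branch b 0 - expo_branch b 0|.
  apply: cvgD; apply: cvgM (cvg_cst _) _; apply: cvg_norm; apply: cvgB => //.
  - exact: cvg_cst.
  - exact: cvg_cst.
  - exact: expo_branch_cvg.
rewrite !subrr !normr0 !mulr0 addr0 in err_cvg.
apply/subr_cvg0/norm_cvg0P; apply: squeeze_cvgr (cvg_cst 0) err_cvg.
near=> b'; have b'0 : 0 < b' by near: b'; exact: lt_nbhsr.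
have y'0 : 0 <= y' b' by apply: iter_lift_ge0 => //; exact: expo_map_lift.
rewrite normr_ge0 /=; apply: le_trans (ler_distD (expo_map b (y' b')) _ _) _.
by rewrite addrC lerD ?expo_map_dist// distrC expo_map_param.
Unshelve. all: by end_near.
Qed.

Lemma expo_map_midpoint_lt b x y n : 0 < b -> n%:R <= x -> x < y -> y <= n.+1%:R ->
  expo_map b ((x + y) / 2) < (expo_map b x + expo_map b y) / 2.
Proof.
move=> b0 nx xy yn.
rewrite !(@expo_mapE _ _ n)//; try by apply/andP; split; lra.
suff : expo_branch b ((x + y) / 2 - n%:R) <
  (expo_branch b (x - n%:R) + expo_branch b (y - n%:R)) / 2 by lra.
rewrite /expo_branch -mulrDl mulrAC ltr_pM2r ?invr_gt0 ?expRB1_gt0//.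
set u := expR (b * (x - n%:R) / 2); set v := expR (b * (y - n%:R) / 2).
have -> : expR (b * ((x + y) / 2 - n%:R)) = u * v by rewrite -expRD; congr expR; lra.
have -> : expR (b * (x - n%:R)) = u * u by rewrite -expRD; congr expR; lra.
have -> : expR (b * (y - n%:R)) = v * v by rewrite -expRD; congr expR; lra.
have uv : u < v by rewrite ltr_expR ltr_pM2r// ltr_pM2l// ltrD2r.
have : 0 < (v - u) * (v - u) by rewrite mulr_gt0 ?subr_gt0.
lra.
Qed.

Lemma expo_map_iter_lt b x y t : 0 < b -> 0 <= x -> x < y ->
  iter t (expo_map b) x < iter t (expo_map b) y.
Proof.
move=> b0 x0 xy; elim: t => //= t IH; apply: expo_map_lt => //.
by apply: iter_lift_ge0 => //; exact: expo_map_lift.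
Qed.

Lemma near0_expo_map_iter b t : 0 < b -> \forall z \near 0^'+,
  iter t (expo_map b) z <= (Num.truncn (iter t (expo_map b) 0)).+1%:R.
Proof.
move=> b0; set y := iter t (expo_map b) 0.
have gap0 : 0 < (Num.truncn y).+1%:R - y by rewrite subr_gt0 truncnS_gt.
have lip0 : 0 < expo_lip b ^+ t by rewrite exprn_gt0// expo_lip_gt0.
near=> z; have z0 : 0 <= z by near: z; exact: nbhs_right_ge.
apply: le_trans (expo_map_iter_lipschitz t b0 z0) _.
rewrite -lerBrDl mulrC -ler_pdivlMr//.
by near: z; apply: nbhs_right_le; rewrite divr_gt0.
Unshelve. all: by end_near.
Qed.

Lemma expo_map_iter_midpoint_lt b z q t : 0 < b -> 0 < z ->
  (forall s : 'I_q, iter s (expo_map b) z <= (Num.truncn (iter s (expo_map b) 0)).+1%:R) ->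
  (t < q)%N ->
  iter t.+1 (expo_map b) (z / 2) <
    (iter t.+1 (expo_map b) 0 + iter t.+1 (expo_map b) z) / 2.
Proof.
move=> b0 z0 no_break; have lift_b := expo_map_lift b0.
have iter0 s : 0 <= iter s (expo_map b) 0 by exact: iter_lift_ge0.
have midpoint s : (s < q)%N ->
    expo_map b ((iter s (expo_map b) 0 + iter s (expo_map b) z) / 2) <
    (iter s.+1 (expo_map b) 0 + iter s.+1 (expo_map b) z) / 2.
  move=> sq; have /andP[trunc_le _] := truncn_itv (iter0 s).
  apply: expo_map_midpoint_lt trunc_le _ (no_break (Ordinal sq)) => //.
  exact: expo_map_iter_lt.
elim: t => [|t IH] tq; first by have := midpoint 0 tq; rewrite /= add0r.
apply: le_lt_trans (midpoint _ tq); apply: expo_map_le => //.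
  by apply: (iter_lift_ge0 t.+1 lift_b); lra.
exact/ltW/IH/ltnW.
Qed.

(* Just to the right of 0, the first [q] iterates avoid the break points, so that the
   [q]-th iterate is strictly convex there. *)
Lemma expo_map_iter_not_translation b q k : 0 < b -> (0 < q)%N ->
  ~ (forall x, 0 <= x -> iter q (expo_map b) x = x + k%:R).
Proof.
move=> b0 q0 translation.
have /filter_ex[z [z0 no_break]] : \forall z \near 0^'+, 0 < z /\ forall s : 'I_q,
    iter s (expo_map b) z <= (Num.truncn (iter s (expo_map b) 0)).+1%:R.
  near=> z; split; first by near: z; exact: nbhs_right_gt.
  by near: z; apply: filter_forall => s; exact: near0_expo_map_iter.
have := expo_map_iter_midpoint_lt b0 z0 no_break (_ : q.-1 < q)%N.
by rewrite !prednK// => /(_ (leqnn _)); rewrite !translation//; lra.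
Unshelve. all: by end_near.
Qed.

End ExponentialCircleMap.

Section ExponentialRotation.
Context {R : realType}.
Implicit Types b l r : R.

Definition expo_rotation b : R := rotation_number (expo_map b).

Lemma expo_rotation_antitone b b' : 0 < b -> b <= b' ->
  expo_rotation b' <= expo_rotation b.
Proof.
move=> b0 bb'; apply: rotation_number_le.
- by apply: expo_map_lift; exact: lt_le_trans bb'.
- exact: expo_map_lift.
- by move=> x; exact: expo_map_antitone.
Qed.

Lemma expo_rotation_ge0 b : 0 < b -> 0 <= expo_rotation b.
Proof.
move=> /expo_map_lift lift_b; rewrite -[leLHS](mul0r 1%:R^-1).
apply: (@rotation_number_ge_ratio _ _ 0 1 0 lift_b) => //.
by rewrite addr0; case: lift_b.
Qed.

(* The iterates divided by [t] converge to the rotation number with an error of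
   [1 / t], uniformly in the parameter. *)
Lemma expo_rotation_continuous b : 0 < b ->
  expo_rotation b' @[b' --> b] --> expo_rotation b.
Proof.
move=> b0; apply/cvgrPdist_le => e e0.
pose t := (Num.truncn (3 / e)).+1.
have /cvgrPdist_le/(_ _ ltr01) iter_cvg := @expo_map_iter_cvg R b 0 t b0 (lexx 0).
near=> b'.
have b'0 : 0 < b' by near: b'; exact: lt_nbhsr.
have iter_close : `|iter t (expo_map b) 0 - iter t (expo_map b') 0| <= 1 by near: b'.
have := bounded_deviation_dist (ltn0Sn _ : (0 < t)%N)
  (rotation_number_deviation (expo_map_lift b0))
  (rotation_number_deviation (expo_map_lift b'0)).
move=> /le_trans; apply; rewrite ler_pdivrMr ?ltr0n// mulrC.
apply: (@le_trans _ _ 3); first by rewrite (_ : 3 = 1 + 1 + 1) ?lerD2l//; lra.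
by rewrite -ler_pdivrMr// ltW// truncnS_gt.
Unshelve. all: by end_near.
Qed.

Lemma expo_rotation_eq0 b : 4 <= b -> expo_rotation b = 0.
Proof.
move=> b4; have b0 : 0 < b by lra.
apply/eqP; rewrite eq_le expo_rotation_ge0// andbT -[leRHS](mul0r 1%:R^-1).
have half0 : 0 <= 1 / 2 :> R by lra.
apply: (@rotation_number_le_ratio _ _ _ 1 0 (expo_map_lift b0) half0) => //.
rewrite addr0 /= expo_map_branch//; last by apply/andP; split; lra.
rewrite /expo_branch ler_pdivrMr ?expRB1_gt0//.
have -> : expR b = expR (b * (1 / 2)) ^+ 2 by rewrite -expRM_natl; congr expR; lra.
have := expR_ge1Dx (b * (1 / 2)); set s := expR _ => s_ge.
have : 0 <= (s - 3) * (s + 1) by rewrite mulr_ge0; lra.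
rewrite expr2; lra.
Qed.

Lemma expo_rotation_ln2 : expo_rotation (ln 2) = 1 :> R.
Proof.
have b0 : 0 < ln 2 :> R by rewrite ln_gt0// ltr1n.
have map0 : iter 1 (expo_map (ln 2)) 0 = 0 + 1%:R :> R.
  rewrite /= expo_map_branch ?lexx ?ler01// /expo_branch mulr0 expR0.
  by rewrite lnK ?posrE// add0r (_ : 2 - 1 = 1) ?divr1//; lra.
have lift_b := expo_map_lift b0; rewrite -[RHS]divr1.
apply/le_anti/andP; split.
- by apply: (@rotation_number_le_ratio _ _ 0 1 1) => //; rewrite map0.
- by apply: (@rotation_number_ge_ratio _ _ 0 1 1) => //; rewrite map0.
Qed.

Lemma expo_map_iter_le_translation b q k x : 0 < b -> (0 < q)%N -> 0 <= x ->
  (\forall b' \near b^'+, expo_rotation b' < k%:R / q%:R) ->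
  iter q (expo_map b) x <= x + k%:R.
Proof.
move=> b0 q0 x0 rot_lt.
have right_cvg : iter q (expo_map b') x @[b' --> b^'+] --> iter q (expo_map b) x.
  by apply: cvg_at_right_filter; exact: expo_map_iter_cvg.
apply: (cvgr_to_le right_cvg).
near=> b'; have bb' : b < b' by near: b'; exact: nbhs_right_gt.
rewrite leNgt; apply/negP => /ltW.
move=> /(rotation_number_ge_ratio (expo_map_lift (lt_trans b0 bb')) x0 q0).
by rewrite leNgt => /negP; apply; near: b'.
Unshelve. all: by end_near.
Qed.

Lemma expo_map_iter_ge_translation b q k x : 0 < b -> (0 < q)%N -> 0 <= x ->
  (\forall b' \near b^'-, k%:R / q%:R < expo_rotation b') ->
  x + k%:R <= iter q (expo_map b) x.
Proof.
move=> b0 q0 x0 rot_gt.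
have left_cvg : iter q (expo_map b') x @[b' --> b^'-] --> iter q (expo_map b) x.
  by apply: cvg_at_left_filter; exact: expo_map_iter_cvg.
apply: (cvgr_to_ge left_cvg).
near=> b'; have b'0 : 0 < b' by near: b'; exact: nbhs_left_gt.
rewrite leNgt; apply/negP => /ltW.
move=> /(rotation_number_le_ratio (expo_map_lift b'0) x0 q0).
by rewrite leNgt => /negP; apply; near: b'.
Unshelve. all: by end_near.
Qed.

Lemma expo_rotation_not_isolated b q k : 0 < b -> (0 < q)%N ->
  (\forall b' \near b^'+, expo_rotation b' < k%:R / q%:R) ->
  ~ (\forall b' \near b^'-, k%:R / q%:R < expo_rotation b').
Proof.
move=> b0 q0 rot_lt rot_gt; apply: (@expo_map_iter_not_translation _ b q k b0 q0) => x x0.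
apply/le_anti/andP; split.
- exact: expo_map_iter_le_translation.
- exact: expo_map_iter_ge_translation.
Qed.

Lemma expo_rotation_locally_constant l r : 0 < l -> l < r ->
  expo_rotation l = expo_rotation r ->
  exists2 b, l < b < r & \forall b' \near b, expo_rotation b' = expo_rotation b.
Proof.
move=> l0 lr; have /andP[l_mid mid_r] : l < (l + r) / 2 < r by apply/andP; split; lra.
move=> rot_lr; have flat b : l <= b <= r -> expo_rotation b = expo_rotation l.
  move=> /andP[lb br]; apply/le_anti/andP; split; first exact: expo_rotation_antitone.
  by rewrite rot_lr; apply: expo_rotation_antitone br; exact: lt_le_trans lb.
exists ((l + r) / 2); first by rewrite l_mid.
near=> b; rewrite (flat ((l + r) / 2)); last by rewrite !ltW.
by apply: flat; apply/andP; split; near: b; [exact: lt_le_nbhsr|exact: lt_le_nbhsl].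
Unshelve. all: by end_near.
Qed.

End ExponentialRotation.

Section RationalPlateaux.
Context {R : realType}.
Implicit Types l r v : R.

Lemma ratr_ge0_ratio (s : rat) : 0 <= s ->
  exists k q : nat, (0 < q)%N /\ ratr s = k%:R / q%:R :> R.
Proof.
move=> s0; exists `|numq s|%N, `|denq s|%N; split; first by rewrite absz_gt0 denq_eq0.
by rewrite /ratr; congr (_ / _); rewrite pmulrn gez0_abs// ?numq_ge0.
Qed.

Lemma expo_rotation_attains l r v : 0 < l -> l < r ->
  expo_rotation r < v < expo_rotation l ->
  exists2 b, l < b < r & expo_rotation b = v.
Proof.
move=> l0 lr /andP[rv vl].
have [b + rot_b] : exists2 b, b \in `[l, r] & expo_rotation b = v.
  apply: IVT; first exact: ltW.
    apply: continuous_in_subspaceT => x; rewrite inE /= in_itv /= => /andP[lx _].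
    by apply: expo_rotation_continuous; exact: lt_le_trans lx.
  by rewrite ge_min le_max; apply/andP; split; apply/orP; [right|left]; exact: ltW.
rewrite in_itv /= !le_eqVlt => /andP[/predU1P[lb|lb] /predU1P[br|br]];
  by [exists b; rewrite ?lb|move: rv vl; rewrite -?br -?rot_b ?lb ltxx].
Qed.

Lemma expo_rotation_locally_constant_dense l r : 0 < l -> l < r ->
  exists2 b, l < b < r & \forall b' \near b, expo_rotation b' = expo_rotation b.
Proof.
move=> l0 lr; have r0 : 0 < r by exact: lt_trans lr.
have := expo_rotation_antitone l0 (ltW lr).
rewrite le_eqVlt => /predU1P[/esym|rot_lt]; first exact: expo_rotation_locally_constant.
have [s] := rat_in_itvoo rot_lt; rewrite in_itv /= => /andP[rs sl].
have s0 : 0 <= s by rewrite -(ler0q R); exact: ltW (le_lt_trans (expo_rotation_ge0 r0) rs).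
have [k [q [q0 s_ratio]]] := ratr_ge0_ratio s0.
have [b /andP[lb br] rot_b] : exists2 b, l < b < r & expo_rotation b = k%:R / q%:R.
  by apply: expo_rotation_attains => //; rewrite -s_ratio rs.
have b0 : 0 < b by exact: lt_trans lb.
have [[a /andP[la ab] rot_a]|no_left] :=
    pselect (exists2 a, l < a < b & expo_rotation a = expo_rotation b).
  have [c /andP[ac cb] flat_c] :=
    expo_rotation_locally_constant (lt_trans l0 la) ab rot_a.
  by exists c => //; rewrite (lt_trans la ac) (lt_trans cb br).
have [[a /andP[ba ar] rot_a]|no_right] :=
    pselect (exists2 a, b < a < r & expo_rotation a = expo_rotation b).
  have [c /andP[bc ca] flat_c] := expo_rotation_locally_constant b0 ba (esym rot_a).
  by exists c => //; rewrite (lt_trans lb bc) (lt_trans ca ar).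
exfalso; apply: (@expo_rotation_not_isolated R b q k b0 q0); rewrite -rot_b.
- near=> a; have ba : b < a by near: a; exact: nbhs_right_gt.
  rewrite lt_neqAle expo_rotation_antitone// ?ltW// andbT.
  apply/eqP => rot_a; apply: no_right; exists a; last exact: esym.
  by rewrite ba; near: a; exact: nbhs_right_lt.
- near=> a; have la : l < a by near: a; exact: nbhs_left_gt.
  have ab : a < b by near: a; exact: nbhs_left_lt.
  rewrite lt_neqAle expo_rotation_antitone ?(ltW ab) ?(lt_trans l0 la)// andbT.
  by apply/eqP => rot_a; apply: no_left; exists a; [rewrite la|exact: esym].
Unshelve. all: by end_near.
Qed.

End RationalPlateaux.

Section LimitActivity.
Context {R : realType}.
Implicit Types p mu l r : R.

Lemma devils_staircase_locally_constant (a b : R) (c : R -> R) : a < b ->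
  {within `[a, b], continuous c} -> {in `[a, b] &, {homo c : x y / x <= y}} ->
  c a = 0 -> c b = 1 ->
  (forall l r, a < l -> l < r -> r < b ->
    exists2 x, l < x < r & \forall y \near x, c y = c x) ->
  devils_staircase a b c.
Proof.
move=> ab cont homo ca cb dense.
have aI : a \in `[a, b] by rewrite in_itv /= lexx ltW.
have bI : b \in `[a, b] by rewrite in_itv /= lexx ltW.
split=> // [x xI|].
  move: (xI); rewrite in_itv /= => /andP[ax xb].
  by rewrite -ca -cb !homo.
exists [set x | \forall y \near x, c y = c x]; split.
- rewrite openE => x /= flat_x; have := near_join flat_x; rewrite /interior.
  apply: filterS2 flat_x => y cyx; apply: filterS => z.
  by rewrite cyx.
- move=> x; rewrite /= in_itv /= => /andP[ax xb] B /nbhs_ballP[e /= e0 eB].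
  pose l := Num.max (x - e) a; pose r := Num.min (x + e) b.
  have lr : l < r by rewrite gt_max !lt_min; apply/andP; split; apply/andP; split; lra.
  have := lexx l; rewrite ge_max => /andP[xl al].
  have := lexx r; rewrite le_min => /andP[rx rb].
  have [y /andP[ly yr] flat_y] : exists2 y,
      (2 * l + r) / 3 < y < (l + 2 * r) / 3 & \forall z \near y, c z = c y.
    by apply: dense; lra.
  exists y; split; first by split=> //=; rewrite in_itv /=; apply/andP; split; lra.
  by apply: eB; rewrite /ball /= ltr_norml; apply/andP; split; lra.
- by move=> x [flat_x _]; apply: filterS flat_x.
Qed.

Definition limit_activity p mu : R := if mu <= 0 then 0 else expo_rotation (p / mu).

Lemma limit_activity_gt0 p mu : 0 < mu -> limit_activity p mu = expo_rotation (p / mu).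
Proof. by rewrite /limit_activity ltNge => /negbTE ->. Qed.

Lemma limit_activity_ge0 p mu : 0 < p -> 0 <= limit_activity p mu.
Proof.
move=> p0; have [mu0|mu0] := leP mu 0; first by rewrite /limit_activity mu0.
by rewrite limit_activity_gt0// expo_rotation_ge0// divr_gt0.
Qed.

Lemma limit_activity_small p mu : 0 < p -> mu <= p / 4 -> limit_activity p mu = 0.
Proof.
move=> p0 small; have [mu0|mu0] := leP mu 0; first by rewrite /limit_activity mu0.
rewrite limit_activity_gt0// expo_rotation_eq0// ler_pdivlMr//.
by rewrite -ler_pdivlMl// mulrC.
Qed.

Lemma limit_activity_homo p : 0 < p -> {homo limit_activity p : mu mu' / mu <= mu'}.
Proof.
move=> p0 mu mu' le_mu; have [mu0|mu0] := leP mu 0.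
  by rewrite {1}/limit_activity mu0 limit_activity_ge0.
have mu'0 : 0 < mu' by exact: lt_le_trans le_mu.
rewrite !limit_activity_gt0//; apply: expo_rotation_antitone; first by rewrite divr_gt0.
by rewrite ler_pM2l// lef_pV2.
Qed.

Lemma cvg_divr p mu : 0 < mu -> p / mu' @[mu' --> mu] --> p / mu.
Proof.
by move=> mu0; apply: cvgM (cvg_cst _) _; apply: cvgV; [rewrite gt_eqF|exact: cvg_id].
Qed.

Lemma limit_activity_continuous p : 0 < p -> continuous (limit_activity p).
Proof.
move=> p0 mu; rewrite /continuous_at.
have p4 : 0 < p / 4 by rewrite divr_gt0.
have [small|large] := ltP mu (p / 4).
  rewrite (limit_activity_small p0 (ltW small)); apply: cvg_near_cst.
  by near=> mu'; apply: limit_activity_small => //; near: mu'; exact: lt_le_nbhsl.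
have mu0 : 0 < mu by exact: lt_le_trans large.
rewrite limit_activity_gt0//.
apply: (@cvg_trans _ (expo_rotation (p / mu') @[mu' --> mu])).
  apply: near_eq_cvg; near=> mu'; rewrite limit_activity_gt0//.
  by near: mu'; exact: lt_nbhsr.
apply: (@cvg_comp _ _ _ (fun mu' => p / mu') expo_rotation _ (nbhs (p / mu))).
  exact: cvg_divr.
by apply: expo_rotation_continuous; rewrite divr_gt0.
Unshelve. all: by end_near.
Qed.

Lemma limit_activity_locally_constant_dense p l r : 0 < p -> 0 < l -> l < r ->
  exists2 mu, l < mu < r &
    \forall mu' \near mu, limit_activity p mu' = limit_activity p mu.
Proof.
move=> p0 l0 lr; have r0 : 0 < r by exact: lt_trans lr.
have pr0 : 0 < p / r by rewrite divr_gt0.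
have prl : p / r < p / l by rewrite ltr_pM2l// ltf_pV2.
have [b /andP[rb bl] flat_b] := expo_rotation_locally_constant_dense pr0 prl.
have b0 : 0 < b by exact: lt_trans rb.
have mu0 : 0 < p / b by rewrite divr_gt0.
exists (p / b).
  by rewrite ltr_pdivlMr// mulrC -ltr_pdivlMr// bl ltr_pdivrMr// mulrC -ltr_pdivrMr.
have bE : p / (p / b) = b by rewrite invf_div mulrC divfK ?gt_eqF.
have div_cvg := cvg_divr (p := p) mu0; rewrite bE in div_cvg.
apply: filterS2 (lt_nbhsr mu0) (div_cvg _ flat_b) => mu' mu'0 flat_mu'.
by rewrite !limit_activity_gt0 ?bE.
Qed.

Lemma limit_activity_staircase p : 0 < p ->
  devils_staircase 0 (p / ln 2) (limit_activity p).
Proof.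
move=> p0; have ln20 : 0 < ln 2 :> R by rewrite ln_gt0// ltr1n.
have b0 : 0 < p / ln 2 by rewrite divr_gt0.
apply: devils_staircase_locally_constant => //.
- exact/continuous_subspaceT/limit_activity_continuous.
- by move=> x y _ _; exact: limit_activity_homo.
- by rewrite /limit_activity lexx.
- by rewrite limit_activity_gt0// invf_div mulrC divfK ?gt_eqF// expo_rotation_ln2.
- by move=> l r l0 lr _; exact: limit_activity_locally_constant_dense.
Qed.

End LimitActivity.

(** * Parallel chip-firing on a finite graph *)

Section NeighbourAverage.
Context {R : realType} {V : finType}.
Implicit Types (e : rel V) (f g : V -> R) (v w : V).

Definition no_isolated e := forall v, (0 < degree e v)%N.

Definition common_neighbours e := forall v w, v != w -> exists x, e v x && e w x.

Definition neighbour_average e f v : R := (\sum_(w | e v w) f w) / (degree e v)%:R.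

Lemma neighbour_average_le e f g v :
  (forall w, f w <= g w) -> neighbour_average e f v <= neighbour_average e g v.
Proof. by move=> fg; rewrite ler_wpM2r ?invr_ge0//; apply: ler_sum. Qed.

Lemma neighbour_average_ge0 e f v :
  (forall w, 0 <= f w) -> 0 <= neighbour_average e f v.
Proof. by move=> f0; rewrite divr_ge0// sumr_ge0. Qed.

Lemma neighbour_averageDr e f v (k : R) : (0 < degree e v)%N ->
  neighbour_average e (fun w => f w + k) v = neighbour_average e f v + k.
Proof.
move=> d0; rewrite /neighbour_average big_split /= mulrDl sumr_const -[k *+ _]mulr_natr.
by rewrite [X in k * X%:R]/(degree e v) mulfK// pnatr_eq0 -lt0n.
Qed.

(* If the Laplacian of [u] is at most [N], then [u] exceeds its minimum by at
   most [N] at the neighbours of a minimiser, and by at most [(#|V| + 2) * N] at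
   the neighbours of these. *)
Lemma laplacian_le_oscillation e (u : V -> R) (N : R) :
  symmetric e -> common_neighbours e ->
  (forall v, \sum_(w | e v w) (u w - u v) <= N) ->
  forall v w, u w <= u v + (#|V|%:R + 2) * N.
Proof.
move=> e_sym e_cn lap v w.
case: (@Order.TotalTheory.arg_minP _ _ _ v predT u isT) => m _ umin.
have {}umin x : u m <= u x by exact: umin.
have N0 : 0 <= N.
  by apply: le_trans (lap m); rewrite sumr_ge0// => x _; rewrite subr_ge0.
suff : u w <= u m + (#|V|%:R + 2) * N by have := umin v; lra.
have [->|wm] := eqVneq w m; first by rewrite lerDl mulr_ge0// addr_ge0.
have [x /andP[wx mx]] := e_cn _ _ wm.
have near_min : u x - u m <= N.
  apply: le_trans (lap m); rewrite (bigD1 x)//= lerDl sumr_ge0// => y _.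
  by rewrite subr_ge0.
have : u w - u x + N <= N + #|V|%:R * N.
  apply: (@le_trans _ _ (\sum_(y | e x y) (u y - u x + N))).
    rewrite (bigD1 w)/= 1?e_sym// lerDl sumr_ge0// => y _.
    by have := umin y; lra.
  rewrite big_split /= lerD//.
  by rewrite sumr_const -(mulr_natl N) ler_wpM2r// ler_nat max_card.
lra.
Qed.

End NeighbourAverage.

Section Odometer.
Context {R : realType} {V : finType}.
Implicit Types (e : rel V) (sigma : V -> R) (u : V -> nat) (v w : V).

Lemma odometerS e sigma t v :
  odometer e sigma t.+1 v =
  (odometer e sigma t v + firings e (iter t (parallel_step e) sigma) v)%N.
Proof. by rewrite /odometer big_ord_recr. Qed.

Lemma odometer0 e sigma v : odometer e sigma 0 v = 0%N.
Proof. by rewrite /odometer big_ord0. Qed.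

Lemma configuration_odometer e sigma t v :
  iter t (parallel_step e) sigma v =
  sigma v - (odometer e sigma t v * degree e v)%:R +
  (\sum_(w | e v w) odometer e sigma t w)%:R.
Proof.
elim: t v => [|t IH] v.
  by rewrite /= odometer0 mul0n subr0 big1 ?addr0// => w _; rewrite odometer0.
rewrite iterS /parallel_step -/(parallel_step e) IH.
under [in RHS]eq_bigr do rewrite odometerS.
rewrite odometerS big_split /= mulnDl !natrD; lra.
Qed.

Lemma configuration_ge0 e sigma t v :
  (forall v, 0 <= sigma v) -> 0 <= iter t (parallel_step e) sigma v.
Proof.
move=> sigma0; elim: t v => [|t IH] v //=.
rewrite /parallel_step addr_ge0// subr_ge0 natrM /firings.
have [->|d0] := posnP (degree e v); first by rewrite mulr0.
by rewrite -ler_pdivlMr ?ltr0n// truncn_le divr_ge0.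
Qed.

Lemma configuration_sum e sigma t : symmetric e ->
  \sum_v iter t (parallel_step e) sigma v = \sum_v sigma v.
Proof.
move=> e_sym; elim: t => [//|t <-]; rewrite iterS /parallel_step -/(parallel_step e).
set s := iter t _ _; set f := firings e s.
rewrite big_split sumrB /= -!natr_sum.
suff -> : (\sum_v \sum_(w | e v w) f w = \sum_v f v * degree e v)%N by lra.
rewrite (exchange_big_dep predT)//=; apply: eq_bigr => w _.
by rewrite sum_nat_const mulnC; congr (_ * _)%N; apply: eq_card => x; rewrite !inE e_sym.
Qed.

Lemma odometer_laplacian_le e sigma t v : symmetric e -> (forall v, 0 <= sigma v) ->
  \sum_(w | e v w) ((odometer e sigma t w)%:R - (odometer e sigma t v)%:R) <=
  \sum_v sigma v.
Proof.
move=> e_sym sigma0.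
rewrite sumrB -natr_sum sumr_const -(mulr_natr _ #|_|) [X in _ - _ * X%:R]/(degree e v).
have : iter t (parallel_step e) sigma v <= \sum_v sigma v.
  rewrite -(configuration_sum sigma t e_sym) (bigD1 v)//= lerDl sumr_ge0// => w _.
  exact: configuration_ge0.
by rewrite configuration_odometer natrM; have := sigma0 v; lra.
Qed.

Lemma odometer_oscillation e sigma : symmetric e -> common_neighbours e ->
  (forall v, 0 <= sigma v) ->
  exists C : nat, forall t v w, (odometer e sigma t w <= odometer e sigma t v + C)%N.
Proof.
move=> e_sym e_cn sigma0.
exists (Num.truncn ((#|V|%:R + 2) * \sum_v sigma v)).+1 => t v w.
rewrite -(ler_nat R) natrD.
have := laplacian_le_oscillation e_sym e_cn
  (fun v => odometer_laplacian_le t v e_sym sigma0) v w.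
by move=> /le_trans; apply; rewrite lerD2l ltW// truncnS_gt.
Qed.

Definition topple e sigma u : V -> nat := fun v =>
  Num.truncn (sigma v / (degree e v)%:R + neighbour_average e (fun w => (u w)%:R) v).

Lemma topple_itv e sigma u v : (forall v, 0 <= sigma v) ->
  (topple e sigma u v)%:R <=
    sigma v / (degree e v)%:R + neighbour_average e (fun w => (u w)%:R) v <
    (topple e sigma u v).+1%:R.
Proof.
move=> sigma0; apply: truncn_itv.
by apply: addr_ge0; [rewrite divr_ge0|exact: neighbour_average_ge0].
Qed.

Lemma topple_odometer e sigma t v : (forall v, 0 <= sigma v) -> no_isolated e ->
  odometer e sigma t.+1 v = topple e sigma (odometer e sigma t) v.
Proof.
move=> sigma0 d0; rewrite odometerS addnC /firings -truncnDr_nat; last first.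
  by rewrite divr_ge0// configuration_ge0.
have dv : (degree e v)%:R != 0 :> R by rewrite pnatr_eq0 -lt0n.
rewrite /topple /neighbour_average configuration_odometer -natr_sum; congr Num.truncn.
by rewrite natrM addrAC mulrBl mulfK// subrK mulrDl.
Qed.

Lemma odometer_iter_topple e sigma t : (forall v, 0 <= sigma v) -> no_isolated e ->
  odometer e sigma t = iter t (topple e sigma) (fun=> 0%N).
Proof.
move=> sigma0 d0; elim: t => [|t IH]; apply/funext => v; first exact: odometer0.
by rewrite topple_odometer// IH.
Qed.

Lemma iter_topple_addn e sigma u k t : no_isolated e -> (forall v, 0 <= sigma v) ->
  iter t (topple e sigma) (fun w => u w + k)%N =
  (fun w => iter t (topple e sigma) u w + k)%N.
Proof.
move=> d0 sigma0; elim: t => //= t ->; apply/funext => v.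
rewrite /topple -truncnDr_nat; last by rewrite addr_ge0 ?neighbour_average_ge0 ?divr_ge0.
rewrite -addrA -neighbour_averageDr//; congr (Num.truncn (_ + _)).
by congr (neighbour_average e _ v); apply/funext => w; rewrite natrD.
Qed.

Lemma iter_topple_homo e sigma sigma' u u' t : (forall v, sigma v <= sigma' v) ->
  (forall v, u v <= u' v)%N ->
  forall v, (iter t (topple e sigma) u v <= iter t (topple e sigma') u' v)%N.
Proof.
move=> ss' uu'; elim: t => [//|t IH] v /=; apply/le_truncn/lerD.
  by rewrite ler_wpM2r ?invr_ge0.
by apply: neighbour_average_le => w; rewrite ler_nat.
Qed.

(* The average over the neighbours of [v] of the number of firings of a vertex
   whose own neighbours have fired [r] times on average. *)
Definition firing_average e sigma v (r : R) : R :=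
  neighbour_average e (fun w => (Num.truncn (sigma w / (degree e w)%:R + r))%:R) v.

Lemma firing_average_lift e sigma v : no_isolated e -> (forall v, 0 <= sigma v) ->
  circle_lift (firing_average e sigma v).
Proof.
move=> d0 sigma0; split=> [|r s r0 rs|r r0].
- exact: neighbour_average_ge0.
- by apply: neighbour_average_le => w; rewrite ler_nat; apply: le_truncn; rewrite lerD2l.
- rewrite -neighbour_averageDr//; congr (neighbour_average e _ v); apply/funext => w.
  by rewrite addrA (truncnDr_nat 1) ?natrD// addr_ge0// divr_ge0.
Qed.

End Odometer.

Section Activity.
Context {R : realType} {V : finType}.
Variables (e : rel V) (v0 : V).
Hypotheses (e_sym : symmetric e) (e_cn : common_neighbours e) (e_iso : no_isolated e).
Implicit Types (sigma : V -> R) (v w : V) (F : R -> R).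

Lemma odometer_quasi_additive sigma v : (forall v, 0 <= sigma v) ->
  exists C : R, quasi_additive (fun t => (odometer e sigma t v)%:R) C.
Proof.
move=> sigma0; have [C osc] := odometer_oscillation e_sym e_cn sigma0.
exists C%:R => s t; set k := odometer e sigma s v.
have odometerD : odometer e sigma (s + t) = iter t (topple e sigma) (odometer e sigma s).
  by rewrite addnC !odometer_iter_topple// iterD.
have from_cst j : iter t (topple e sigma) (fun=> j) v = (odometer e sigma t v + j)%N.
  have := iter_topple_addn (fun=> 0%N) j t e_iso sigma0.
  by rewrite odometer_iter_topple// => /(congr1 (fun f => f v)).
have upper : (odometer e sigma (s + t) v <= odometer e sigma t v + (k + C))%N.
  by rewrite odometerD -from_cst; apply: iter_topple_homo => // w; exact: osc.
have lower : (odometer e sigma t v + k <= odometer e sigma (s + t) v + C)%N.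
  have := iter_topple_addn (odometer e sigma s) C t e_iso sigma0.
  rewrite -odometerD => /(congr1 (fun f => f v)) /= <-.
  by rewrite -from_cst; apply: iter_topple_homo => // w; exact: osc.
by move: upper lower; rewrite -!(ler_nat R) !natrD ler_norml -/k; lra.
Qed.

Lemma odometer_slope sigma : (forall v, 0 <= sigma v) ->
  exists a C : R, forall v, bounded_deviation (fun t => (odometer e sigma t v)%:R) a C.
Proof.
move=> sigma0; have [C osc] := odometer_oscillation e_sym e_cn sigma0.
have [D /quasi_additive_slope[a v0a]] := odometer_quasi_additive v0 sigma0.
exists a, (C%:R + D) => v t.
have := v0a t; have := osc t v v0; have := osc t v0 v.
by rewrite -!(ler_nat R) !natrD !ler_norml; lra.
Qed.

Lemma activityE sigma a : is_activity e sigma a -> activity e sigma = a.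
Proof.
move=> act_a; rewrite /activity; case: xgetP => [b _ act_b|/(_ a)//].
exact: (cvg_unique _ (act_b v0) (act_a v0)).
Qed.

Lemma activity_deviation sigma : (forall v, 0 <= sigma v) ->
  exists C, forall v,
    bounded_deviation (fun t => (odometer e sigma t v)%:R) (activity e sigma) C.
Proof.
move=> sigma0; have [a [C dev]] := odometer_slope sigma0; exists C.
by rewrite (activityE (a := a))// => v; exact: bounded_deviation_cvg (dev v).
Qed.

Lemma activity_homo sigma sigma' : (forall v, 0 <= sigma v) ->
  (forall v, sigma v <= sigma' v) -> activity e sigma <= activity e sigma'.
Proof.
move=> sigma0 ss'.
have sigma'0 v : 0 <= sigma' v by exact: le_trans (sigma0 _) (ss' _).
have [C dev] := activity_deviation sigma0; have [C' dev'] := activity_deviation sigma'0.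
apply: (bounded_deviation_le (dev v0) (dev' v0) (D := 0)) => t.
by rewrite addr0 ler_nat !odometer_iter_topple//; exact: iter_topple_homo.
Qed.

Lemma activity0 : activity e (fun=> 0 : R) = 0.
Proof.
apply: activityE => v; rewrite (_ : (fun n => _) = cst 0); first exact: cvg_cst.
apply/funext => n; rewrite odometer_iter_topple//.
suff -> : iter n (topple e (fun=> 0 : R)) (fun=> 0%N) = fun=> 0%N by rewrite mul0r.
elim: n => //= n ->; apply/funext => w.
by rewrite /topple /neighbour_average big1// !mul0r addr0 truncn0.
Qed.

Lemma neighbour_average_odometer_le sigma F t v : (forall v, 0 <= sigma v) ->
  circle_lift F -> (forall v r, 0 <= r < 1 -> firing_average e sigma v r <= F r) ->
  neighbour_average e (fun w => (odometer e sigma t w)%:R) v <= iter t F 0.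
Proof.
move=> sigma0 liftF avgF; elim: t v => [|t IH] v.
  by rewrite /neighbour_average big1 ?mul0r// => w _; rewrite odometer0.
have itF0 : 0 <= iter t F 0 by exact: iter_lift_ge0.
have lift_avg w := firing_average_lift w e_iso sigma0.
apply: le_trans (circle_lift_le_itv01 (lift_avg v) liftF (avgF v) itF0).
apply: neighbour_average_le => w.
by rewrite topple_odometer// ler_nat; apply: le_truncn; rewrite lerD2l.
Qed.

Lemma neighbour_average_odometer_ge sigma F t v : (forall v, 0 <= sigma v) ->
  circle_lift F -> (forall v r, 0 <= r < 1 -> F r <= firing_average e sigma v r) ->
  iter t F 0 <= neighbour_average e (fun w => (odometer e sigma t w)%:R) v.
Proof.
move=> sigma0 liftF avgF; elim: t v => [|t IH] v; first exact: neighbour_average_ge0.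
have itF0 : 0 <= iter t F 0 by exact: iter_lift_ge0.
have lift_avg w := firing_average_lift w e_iso sigma0.
apply: le_trans (circle_lift_le_itv01 liftF (lift_avg v) (avgF v) itF0) _.
apply: neighbour_average_le => w.
by rewrite topple_odometer// ler_nat; apply: le_truncn; rewrite lerD2l.
Qed.

Lemma activity_le_rotation sigma F : (forall v, 0 <= sigma v) -> circle_lift F ->
  (forall v r, 0 <= r < 1 -> firing_average e sigma v r <= F r) ->
  activity e sigma <= rotation_number F.
Proof.
move=> sigma0 liftF avgF; have [C dev] := activity_deviation sigma0.
apply: (bounded_deviation_le (bounded_deviation_succ (dev v0))
  (rotation_number_deviation liftF) (D := sigma v0 / (degree e v0)%:R)) => t.
rewrite topple_odometer//.
have /andP[topple_le _] := topple_itv e (odometer e sigma t) v0 sigma0.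
apply: le_trans topple_le _.
by rewrite addrC lerD2r; exact: neighbour_average_odometer_le.
Qed.

Lemma activity_ge_rotation sigma F : (forall v, 0 <= sigma v) -> circle_lift F ->
  (forall v r, 0 <= r < 1 -> F r <= firing_average e sigma v r) ->
  rotation_number F <= activity e sigma.
Proof.
move=> sigma0 liftF avgF; have [C dev] := activity_deviation sigma0.
apply: (bounded_deviation_le (rotation_number_deviation liftF)
  (bounded_deviation_succ (dev v0)) (D := 1)) => t.
rewrite topple_odometer// natr1.
have /andP[_ /ltW] := topple_itv e (odometer e sigma t) v0 sigma0.
apply: le_trans; apply: (le_trans (neighbour_average_odometer_ge t v0 sigma0 liftF avgF)).
by rewrite lerDr divr_ge0.
Qed.

End Activity.

(** * Chernoff bounds *)

Section TailMgf.
Context {R : realType}.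
Implicit Types (theta x c q : R) (f : nat -> R).

(* By summation by parts, the moment generating function at [theta] of a variable
   with values in [{0, ..., M}] that exceeds [a] with probability [f a]. *)
Definition tail_mgf theta M f : R :=
  1 + \sum_(a < M) (expR (theta * a.+1%:R) - expR (theta * a%:R)) * f a.

Lemma tail_mgf_recr theta M f : tail_mgf theta M.+1 f =
  tail_mgf theta M f + (expR (theta * M.+1%:R) - expR (theta * M%:R)) * f M.
Proof. by rewrite /tail_mgf big_ord_recr addrA. Qed.

Lemma tail_mgf1 theta M : tail_mgf theta M (fun=> 1) = expR (theta * M%:R).
Proof.
rewrite /tail_mgf; under eq_bigr do rewrite mulr1.
rewrite -(big_mkord xpredT (fun a => expR (theta * a.+1%:R) - expR (theta * a%:R))).
by rewrite (telescope_sumr (fun a => expR (theta * a%:R)))// mulr0 expR0 addrC subrK.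
Qed.

Lemma tail_mgf_ge0 theta M f : (forall a, 0 <= f a <= 1) -> 0 <= tail_mgf theta M f.
Proof.
move=> f01; have [theta0|theta0] := leP 0 theta.
  rewrite addr_ge0// sumr_ge0// => a _; have /andP[f0 _] := f01 a.
  by rewrite mulr_ge0// subr_ge0 ler_expR ler_wpM2l// ler_nat.
apply: le_trans (expR_ge0 (theta * M%:R)) _.
rewrite -tail_mgf1 lerD2l; apply: ler_sum => a _; have /andP[_ f1] := f01 a.
by rewrite ler_wnM2l// subr_le0 ler_expR ler_nM2l// ler_nat.
Qed.

Lemma expRB1_le x : expR x - 1 <= x * expR x.
Proof.
have := expR_ge1Dx (- x); rewrite -(ler_pM2l (expR_gt0 x)) -expRD addrN expR0; lra.
Qed.

Lemma tail_mgf_geometric theta c q M f : 0 < theta -> 0 <= c -> 0 <= q ->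
  expR theta * q < 1 -> (forall a, f a <= c * q ^+ a) ->
  tail_mgf theta M f <= expR (theta * (expR theta * c / (1 - expR theta * q))).
Proof.
move=> theta0 c0 q0; set y := expR theta => yq1 fq.
have y0 : 0 < y by exact: expR_gt0.
have y1 : 0 <= y - 1 by rewrite subr_ge0 -(expR0 R) ler_expR ltW.
have yq0 : 0 <= y * q by rewrite mulr_ge0// ltW.
apply: le_trans (expR_ge1Dx _); rewrite lerD2l.
apply: (@le_trans _ _ (\sum_(a < M) (y - 1) * c * (y * q) ^+ a)).
  apply: ler_sum => a _; rewrite !(mulrC theta) !expRM_natl -/y exprS exprMn.
  have ya0 : 0 <= (y - 1) * y ^+ a by rewrite mulr_ge0// exprn_ge0// ltW.
  have := ler_wpM2l ya0 (fq a); lra.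
rewrite -mulr_sumr; apply: (@le_trans _ _ ((y - 1) * c * (1 - y * q)^-1)).
  apply: ler_wpM2l; first exact: mulr_ge0.
  rewrite -[leRHS]mul1r ler_pdivlMr ?subr_gt0// mulrC -opprB mulNr -subrX1 opprB.
  by rewrite lerBlDr lerDl exprn_ge0.
rewrite !mulrA ler_wpM2r ?invr_ge0 ?subr_ge0 ?(ltW yq1)// ler_wpM2r//.
exact: expRB1_le.
Qed.

Lemma cvg_expRM_at_right0 c : expR (theta * c) @[theta --> 0^'+] --> (1 : R).
Proof.
have one : expR (0 * c) = 1 by rewrite mul0r expR0.
rewrite -[X in _ --> X]one; apply: cvg_at_right_filter.
apply: continuous_cvg; first exact: continuous_expR.
by apply: cvgM; [exact: cvg_id|exact: cvg_cst].
Qed.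

Lemma expRM_small_lt c S x : S < x ->
  exists2 theta, 0 < theta & expR (theta * c) * S < x.
Proof.
move=> Sx; have S1x : 1 * S < x by rewrite mul1r.
have S_cvg : expR (theta * c) * S @[theta --> 0^'+] --> 1 * S.
  by apply: cvgM (cvg_cst _); exact: cvg_expRM_at_right0.
have : \forall theta \near 0^'+, 0 < theta /\ expR (theta * c) * S < x.
  near=> theta; split; first by near: theta; exact: nbhs_right_gt.
  by near: theta; exact: (cvgr_lt _ S_cvg _ S1x).
by move=> /filter_ex[theta [theta0 Stheta]]; exists theta.
Unshelve. all: by end_near.
Qed.

Lemma expRM_small_gt c S x : x < S ->
  exists2 theta, 0 < theta & x < expR (theta * c) * S.
Proof.
rewrite -ltrN2 => /(expRM_small_lt c)[theta theta0]; rewrite mulrN ltrN2.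
by exists theta.
Qed.

(* [c / (1 - q)] bounds the expectation. *)
Lemma tail_mgf_upper c q x : 0 <= c -> 0 <= q < 1 -> c < x * (1 - q) ->
  exists theta x', [/\ 0 < theta, x' < x & forall M f,
    (forall a, f a <= c * q ^+ a) -> tail_mgf theta M f <= expR (theta * x')].
Proof.
move=> c0 /andP[q0 q1] cx; have cqx : c + x * q < x by lra.
have x0 : 0 < x.
  by have := le_lt_trans c0 cx; rewrite pmulr_lgt0// subr_gt0.
have [theta theta0] := expRM_small_lt 1 cqx; rewrite mulr1 => yx.
have y0 := expR_gt0 theta.
have yq1 : expR theta * q < 1.
  by rewrite -(ltr_pM2l x0); have := mulr_ge0 (ltW y0) c0; lra.
exists theta, (expR theta * c / (1 - expR theta * q)); split=> //.
  by rewrite ltr_pdivrMr ?subr_gt0//; lra.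
by move=> M f; exact: tail_mgf_geometric.
Qed.

Lemma tail_mgf_opp_le theta M f0 f : 0 <= theta -> (forall a, 0 <= f0 a <= f a) ->
  tail_mgf (- theta) M f <=
    expR (- theta * (expR (- (theta * M%:R)) * \sum_(a < M) f0 a)).
Proof.
move=> theta0 f0f; apply: le_trans (expR_ge1Dx _); rewrite lerD2l.
rewrite mulNr mulrA mulr_sumr -sumrN; apply: ler_sum => a _.
rewrite -opprB mulNr lerN2; have /andP[f00 f0fa] := f0f a.
apply: ler_pM => //; first by rewrite mulr_ge0 ?expR_ge0.
have -> : - theta * a%:R = theta + - theta * a.+1%:R by rewrite -natr1; lra.
rewrite expRD -[X in _ <= _ - X]mul1r -mulrBl.
apply: ler_pM => //; first by rewrite lerBrDl expR_ge1Dx.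
by rewrite ler_expR mulNr lerN2 ler_wpM2l// ler_nat.
Qed.

Lemma tail_mgf_lower M f0 x : (forall a, 0 <= f0 a) -> x < \sum_(a < M) f0 a ->
  exists theta x', [/\ theta < 0, x < x' & forall f,
    (forall a, f0 a <= f a) -> tail_mgf theta M f <= expR (theta * x')].
Proof.
move=> f00 /(expRM_small_gt (- M%:R))[theta theta0 x_lt].
exists (- theta), (expR (theta * - M%:R) * \sum_(a < M) f0 a).
split; rewrite ?oppr_lt0// => f f0f.
by rewrite mulrN; apply: tail_mgf_opp_le (ltW theta0) _ => a; rewrite f00 f0f.
Qed.

Lemma chernoff_rate theta x x' (B : R) n m : 0 <= B -> B <= expR (theta * x') ->
  (m <= n <= m + 2)%N ->
  expR (- (theta * (x * n%:R))) * B ^+ m <=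
    expR (2 * `|theta * x'|) * expR (- (theta * (x - x'))) ^+ n.
Proof.
move=> B0 Bx' /andP[]; rewrite -!(ler_nat R) natrD => mn nm.
apply: (@le_trans _ _ (expR (- (theta * (x * n%:R))) * expR (theta * x') ^+ m)).
  by rewrite ler_wpM2l ?expR_ge0// lerXn2r ?nnegrE ?expR_ge0.
rewrite -!expRM_natl -!expRD ler_expR; set z := theta * x'.
have z_norm : 0 <= `|z| + z by rewrite -lerBlDr sub0r -normrN ler_norm.
have nm0 : 0 <= n%:R - m%:R :> R by rewrite subr_ge0.
have nm2 : 0 <= 2 - (n%:R - m%:R) :> R by lra.
have := mulr_ge0 nm0 z_norm; have := mulr_ge0 nm2 (normr_ge0 z).
rewrite mulrBr -/z; lra.
Qed.

End TailMgf.

Section LevelSets.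
Context {R : realType} {Omega : Type}.
Implicit Types (A : nat -> set Omega) (w : Omega) (theta : R).

Definition level A (k : nat) : set Omega := if k is a.+1 then A a else setT.

Definition level_weight theta (k : nat) : R :=
  if k is a.+1 then expR (theta * a.+1%:R) - expR (theta * a%:R) else 1.

Lemma expR_level_sum A theta M w : (forall a, A a.+1 `<=` A a) ->
  expR (theta * \sum_(a < M) \1_(A a) w) = tail_mgf theta M (fun a => \1_(A a) w).
Proof.
move=> nest; elim: M => [|M IH]; first by rewrite /tail_mgf !big_ord0 mulr0 expR0 addr0.
rewrite tail_mgf_recr big_ord_recr /= mulrDr expRD IH indicE.
have [|_] := boolP (w \in A M); last by rewrite !mulr0 expR0 mulr1 addr0.
rewrite inE => AM.
have anti : {homo A : a a' / (a <= a')%N >-> a' `<=` a}.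
  apply: (@homo_leq _ A (fun B C => C `<=` B)) => // [B|C B D CB DC].
    exact: subset_refl.
  exact: subset_trans CB.
have full : \sum_(a < M) \1_(A a) w = M%:R :> R.
  rewrite (eq_bigr (fun=> 1)) => [|a _]; first by rewrite sumr_const card_ord.
  by rewrite indicE mem_set//; apply: anti AM; exact: ltnW.
by rewrite -IH full !mulr1 -natr1 mulrDr mulr1 expRD; lra.
Qed.

Lemma tail_mgf_level theta M (g : nat -> R) : g 0 = 1 ->
  tail_mgf theta M (fun a => g a.+1) = \sum_(k < M.+1) level_weight theta k * g k.
Proof. by move=> g0; rewrite big_ord_recl /= mul1r g0. Qed.

Lemma prod_tail_mgf_expand (I : finType) (Q : pred I) theta M (g : I -> nat -> R) :
  (forall i, Q i -> g i 0 = 1) ->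
  \prod_(i | Q i) tail_mgf theta M (fun a => g i a.+1) =
  \sum_(f in pffun_on (ord0 : 'I_M.+1) Q predT)
    (\prod_(i | Q i) level_weight theta (f i)) * \prod_(i | Q i) g i (f i).
Proof.
move=> g0; under eq_bigr => i Qi do rewrite tail_mgf_level ?g0//.
rewrite (@big_distr_big _ _ _ _ _ _ _ ord0 Q predT
  (fun i (k : 'I_M.+1) => level_weight theta k * g i k)).
by apply: eq_bigr => f _; rewrite big_split.
Qed.

Lemma prod_indic (I : finType) (Q : pred I) (B : I -> set Omega) w :
  \prod_(i | Q i) \1_(B i) w = \1_(\bigcap_(i in [set i | Q i]) B i) w :> R.
Proof.
rewrite [RHS]indicE; have [|] := boolP (w \in _).
  by rewrite inE => Bw; rewrite big1// => i Qi; rewrite indicE mem_set//; exact: Bw.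
rewrite notin_setE => nBw; have [i Qi nBi] : exists2 i, Q i & ~ B i w.
  apply: contrapT => no_i; apply: nBw => i Qi.
  by apply: contrapT => nBi; apply: no_i; exists i.
by rewrite (bigD1 i)//= indicE memNset// mul0r.
Qed.

End LevelSets.

Section Concentration.
Context {R : realType} {d : measure_display} {Omega : measurableType d}
  (P : probability Omega R).

Lemma probability_le_lincomb (J : finType) (Q : pred J) (A : set Omega)
    (B : J -> set Omega) (c : J -> R) :
  measurable A -> (forall j, measurable (B j)) ->
  (forall w, \1_A w <= \sum_(j | Q j) c j * \1_(B j) w) ->
  (P A <= (\sum_(j | Q j) c j * fine (P (B j)))%:E)%E.
Proof.
move=> mA mB AB.
have iB j : P.-integrable setT (fun w => (c j)%:E * (\1_(B j) w)%:E)%E.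
  by apply: integrableZl => //; exact: integrable_indic.
have -> : P A = (\int[P]_w (\1_A w)%:E)%E by rewrite integral_indic// setIT.
have -> : (\sum_(j | Q j) c j * fine (P (B j)))%:E =
    (\int[P]_w (\sum_(j | Q j) (c j)%:E * (\1_(B j) w)%:E))%E.
  rewrite integral_sum// -sumEFin; apply: eq_bigr => j _.
  rewrite integralZl//; last exact: integrable_indic.
  by rewrite integral_indic// setIT EFinM fineK// fin_num_measure.
apply: le_integral => //; first exact: integrable_indic.
  exact: integrable_sum.
move=> w _ /=; under eq_bigr do rewrite -EFinM.
by rewrite sumEFin lee_fin.
Qed.

Lemma probability_bigcup_le (J : finType) (B : J -> set Omega) (b : R) :
  (forall j, measurable (B j)) -> (forall j, (P (B j) <= b%:E)%E) ->
  (P (\bigcup_j B j) <= (#|J|%:R * b)%:E)%E.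
Proof.
move=> mB Bb; apply: (@le_trans _ _ (\sum_(j : J) 1 * fine (P (B j)))%:E).
  apply: probability_le_lincomb => // [|w].
    by apply: fin_bigcup_measurable => //; exact: finite_finset.
  rewrite indicE; have [|_] := boolP (w \in _); last first.
    by rewrite sumr_ge0// => j _; rewrite mul1r.
  rewrite inE => -[j _ Bj]; rewrite (bigD1 j)//= mul1r indicE mem_set// lerDl.
  by rewrite sumr_ge0// => i _; rewrite mul1r.
rewrite lee_fin mulr_natl -sumr_const; apply: ler_sum => j _.
by rewrite mul1r -lee_fin fineK// fin_num_measure.
Qed.

Lemma measurable_level_sum_ge (I : finType) (Q : pred I) (A : I -> nat -> set Omega) M
    (theta c : R) : (forall i a, Q i -> measurable (A i a)) ->
  measurable [set w | c <= theta * \sum_(i | Q i) \sum_(a < M) \1_(A i a) w].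
Proof.
move=> mA; rewrite -[X in measurable X]setTI; apply: measurable_fun_le => //.
apply: measurable_realfun.measurable_funM => //.
under eq_fun do rewrite big_mkcond /=.
apply: measurable_sum => i; have [Qi|//] := boolP (Q i).
by apply: measurable_sum => a; apply: measurable_realfun.measurable_indic; exact: mA.
Qed.

(* [expR (theta * X)] is a linear combination of the indicators of the events
   [X > a], so the product rule is needed for these events but not for their
   complements. *)
Lemma level_chernoff (I : finType) (Q : pred I) (A : I -> nat -> set Omega) M
    (theta S : R) :
  (forall i a, Q i -> measurable (A i a)) ->
  (forall i a, Q i -> A i a.+1 `<=` A i a) ->
  (forall f : I -> nat, fine (P (\bigcap_(i in [set i | Q i]) level (A i) (f i))) =
    \prod_(i | Q i) fine (P (level (A i) (f i)))) ->
  (P [set w | (theta * S <= theta * \sum_(i | Q i) \sum_(a < M) \1_(A i a) w)%R] <=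
   (expR (- (theta * S)) *
     \prod_(i | Q i) tail_mgf theta M (fun a => fine (P (A i a))))%:E)%E.
Proof.
move=> mA nest indep; set E := [set w | _].
have mlevel i k : Q i -> measurable (level (A i) k) by case: k => //= a; exact: mA.
rewrite (prod_tail_mgf_expand _ _ (g := fun i k => fine (P (level (A i) k)))); last first.
  by move=> i _; rewrite probability_setT.
rewrite mulr_sumr.
under eq_bigr do rewrite -(indep (fun i => val (_ i))) mulrA.
apply: probability_le_lincomb => [|f|w].
- exact: measurable_level_sum_ge.
- by apply: fin_bigcap_measurable => [|i Qi]; [exact: finite_finset|exact: mlevel].
under eq_bigr do rewrite -mulrA -prod_indic.
rewrite -mulr_sumr -(prod_tail_mgf_expand _ _ (g := fun i k => \1_(level (A i) k) w)).
  have -> : \prod_(i | Q i) tail_mgf theta M (fun a => \1_(level (A i) a.+1) w) =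
      expR (theta * \sum_(i | Q i) \sum_(a < M) \1_(A i a) w).
    rewrite mulr_sumr expR_sum; apply: eq_bigr => i Qi.
    by rewrite expR_level_sum// => a; exact: nest.
  rewrite -expRD indicE; have [|_] := boolP (w \in E); last exact: expR_ge0.
  by rewrite inE /E /= => Ew; rewrite -[leLHS]expR0 ler_expR; lra.
by move=> i _; rewrite /= indicT.
Qed.

End Concentration.

Section GeometricBounds.
Context {R : realType}.

Lemma bernoulli_inequality (h : R) n : 0 <= h -> 1 + n%:R * h <= (1 + h) ^+ n.
Proof.
move=> h0; elim: n => [|n IH]; first by rewrite mul0r addr0 expr0.
rewrite exprS -natr1; have h1 : 0 <= 1 + h by rewrite addr_ge0.
have := ler_wpM2l h1 IH.
have : 0 <= n%:R * (h * h) by rewrite !mulr_ge0.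
lra.
Qed.

Lemma natr_geometric_bound (k : R) : 0 < k < 1 ->
  exists C k', [/\ 0 <= C, 0 < k' < 1 & forall n, n%:R * k ^+ n <= C * k' ^+ n].
Proof.
move=> /andP[k0 k1]; pose h := (1 - k) / 2; have h0 : 0 < h by rewrite divr_gt0// subr_gt0.
exists h^-1, ((1 + h) * k); split.
- by rewrite invr_ge0 ltW.
- by rewrite mulr_gt0 ?addr_gt0//= /h; nra.
- move=> n; rewrite ler_pdivlMl// mulrA exprMn ler_wpM2r ?exprn_ge0 ?(ltW k0)//.
  have := bernoulli_inequality n (ltW h0); lra.
Qed.

Lemma exprn_geometric_bound (k : R) m : 0 < k < 1 ->
  exists C k', [/\ 0 <= C, 0 < k' < 1 & forall n, n%:R ^+ m * k ^+ n <= C * k' ^+ n].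
Proof.
move=> k01; elim: m => [|m [C [k' [C0 k'01 bound]]]].
  by exists 1, k; split=> // n; rewrite expr0.
have [C' [k'' [C'0 k''01 bound']]] := natr_geometric_bound k'01.
exists (C * C'), k''; split=> // [|n]; first exact: mulr_ge0.
rewrite exprS -mulrA; apply: (@le_trans _ _ (n%:R * (C * k' ^+ n))).
  by rewrite ler_wpM2l.
by rewrite mulrCA -mulrA ler_wpM2l.
Qed.

Lemma nneseries_geometric_lt_pinfty (C k : R) : 0 <= C -> 0 < k < 1 ->
  (\sum_(0 <= n <oo) (C * k ^+ n)%:E < +oo)%E.
Proof.
move=> C0 /andP[k0 k1]; apply: (@le_lt_trans _ _ (C / (1 - k))%:E); last exact: ltry.
apply: lime_le.
  by apply: is_cvg_nneseries => n _ _; rewrite lee_fin mulr_ge0 ?exprn_ge0 ?(ltW k0).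
apply: nearW => n; rewrite sumEFin lee_fin.
by apply: geometric_le_lim => //; rewrite ger0_norm// ltW.
Qed.

End GeometricBounds.

Section AlmostSure.
Context {R : realType} {d : measure_display} {Omega : measurableType d}
  (P : probability Omega R).

Lemma borel_cantelli_ae (E : nat -> set Omega) : (forall n, measurable (E n)) ->
  (\sum_(0 <= n <oo) P (E n) < +oo)%E ->
  {ae P, forall w, \forall n \near \oo, ~ E n w}.
Proof.
move=> mE sumE; exists (lim_sup_set E); split; last 1 first.
- move=> w /= often n _; apply: contrapT => rarely; apply: often.
  by exists n => // m /= nm Em; apply: rarely; exists m.
- by apply: bigcap_measurable => // n _; exact: bigcup_measurable.
- exact: lim_sup_set_cvg0.
Qed.

Lemma borel_cantelli_exponential (E : nat -> set Omega) (C k : R) m : 0 < k < 1 ->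
  (forall n, measurable (E n)) ->
  (\forall n \near \oo, (P (E n) <= (C * n%:R ^+ m * k ^+ n)%:E)%E) ->
  {ae P, forall w, \forall n \near \oo, ~ E n w}.
Proof.
move=> k01 mE [N _ PE].
have [C' [k' [C'0 k'01 bound]]] := exprn_geometric_bound m k01.
pose F n := if (N <= n)%N then E n else set0.
have mF n : measurable (F n) by rewrite /F; case: ifP.
have D0 : 0 <= `|C| * C' by rewrite mulr_ge0.
have sumF : (\sum_(0 <= n <oo) P (F n) < +oo)%E.
  apply: le_lt_trans (nneseries_geometric_lt_pinfty D0 k'01).
  apply: lee_nneseries => // n _; have /andP[/ltW k'0 _] := k'01.
  rewrite /F; case: ifP => Nn; last by rewrite measure0 lee_fin mulr_ge0 ?exprn_ge0.
  apply: le_trans (PE n Nn) _; rewrite lee_fin -!mulrA.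
  apply: (@le_trans _ _ (`|C| * (n%:R ^+ m * k ^+ n))).
    rewrite ler_wpM2r ?ler_norm// mulr_ge0 ?exprn_ge0//.
    by case/andP : k01 => /ltW.
  by rewrite ler_wpM2l.
apply: filterS (borel_cantelli_ae mF sumF) => w [N' _ FN'].
exists (maxn N N') => // n /=; rewrite geq_max => /andP[Nn N'n] En.
by apply: (FN' n N'n); rewrite /F Nn.
Qed.

Lemma ae_forall_countable (T : countType) (Q : T -> Omega -> Prop) :
  (forall x, {ae P, forall w, Q x w}) -> {ae P, forall w, forall x, Q x w}.
Proof.
move=> aeQ.
have : {ae P, forall w, forall n, if unpickle n is Some x then Q x w else True}.
  by apply: ae_foralln => n; case: (unpickle n) => [x|]; [exact: aeQ|exact: aeW].
by apply: filterS => w Qw x; have := Qw (pickle x); rewrite pickleK.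
Qed.

Lemma ae_cvg (f : nat -> Omega -> R) (l : R) :
  (forall e, 0 < e -> {ae P, forall w, \forall n \near \oo, `|l - f n w| <= e}) ->
  {ae P, forall w, f n w @[n --> \oo] --> l}.
Proof.
move=> fl.
have : {ae P, forall w, forall m, \forall n \near \oo, `|l - f n w| <= m.+1%:R^-1}.
  by apply: ae_foralln => m; apply: fl; rewrite invr_gt0.
apply: filterS => w fw; apply/cvgrPdist_le => e e0.
apply: filterS (fw (Num.truncn e^-1)) => n /le_trans; apply.
by rewrite invf_ple ?posrE// ltW// truncnS_gt.
Qed.

End AlmostSure.

Lemma homo_cvg_rat {R : realType} (f : nat -> R -> R) (g : R -> R) (x : R) : 0 <= x ->
  (\forall n \near \oo, forall y z, 0 <= y -> y <= z -> f n y <= f n z) ->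
  (forall q : rat, 0 <= ratr q :> R -> f n (ratr q) @[n --> \oo] --> g (ratr q)) ->
  {for x, continuous g} -> f n x @[n --> \oo] --> g x.
Proof.
move=> x0 f_homo f_rat /cvgrPdist_le g_cont.
move: x0; rewrite le_eqVlt => /predU1P[<-|x0].
  by rewrite -(rmorph0 (@ratr R)); apply: f_rat; rewrite rmorph0.
apply/cvgrPdist_le => e e0; have e2 : 0 < e / 2 by rewrite divr_gt0.
have /nbhs_ballP[r /= r0 r_close] := g_cont _ e2.
have [q] : exists q : rat, ratr q \in `]Num.max 0 (x - r), x[.
  by apply: rat_in_itvoo; rewrite gt_max x0 ltrBlDr ltrDl.
rewrite in_itv /= gt_max => /andP[/andP[q0 rq] qx].
have [q'] : exists q : rat, ratr q \in `]x, x + r[.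
  by apply: rat_in_itvoo; rewrite ltrDl.
rewrite in_itv /= => /andP[xq' q'r].
have g_q : `|g x - g (ratr q)| <= e / 2.
  by apply: r_close; rewrite /ball /= ltr_norml; apply/andP; split; lra.
have g_q' : `|g x - g (ratr q')| <= e / 2.
  by apply: r_close; rewrite /ball /= ltr_norml; apply/andP; split; lra.
have /cvgrPdist_le/(_ _ e2) f_q := f_rat q (ltW q0).
have /cvgrPdist_le/(_ _ e2) f_q' := f_rat q' (ltW (lt_trans x0 xq')).
apply: filterS3 f_homo f_q f_q' => n f_homo.
have := f_homo _ _ (ltW q0) (ltW qx); have := f_homo _ _ (ltW x0) (ltW xq').
by move: g_q g_q'; rewrite !ler_norml; lra.
Qed.

(** * Discretization *)

Section BranchComparison.
Context {R : realType}.
Implicit Types b y h eps : R.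

Lemma expo_branch_survival b y : 0 < b ->
  expo_branch b y * (1 - expR (- b)) = expR (- (b * (1 - y))).
Proof.
move=> b0; have -> : 1 - expR (- b) = (expR b - 1) * expR (- b).
  by rewrite mulrBl mul1r -expRD addrN expR0.
by rewrite /expo_branch mulrA divfK ?gt_eqF ?expRB1_gt0// -expRD; congr expR; lra.
Qed.

(* [expR (- (b * (a + 1 - y)))] is the probability that [floor (X + y) > a] for an
   exponential variable [X] of rate [b]. *)
Lemma expo_tail_sum b y M : 0 < b ->
  \sum_(a < M) expR (- (b * (a.+1%:R - y))) = expo_branch b y * (1 - expR (- b) ^+ M).
Proof.
move=> b0; have -> : 1 - expR (- b) ^+ M = (1 - expR (- b)) * \sum_(a < M) expR (- b) ^+ a.
  by rewrite -[LHS]opprB subrX1 -mulNr opprB.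
rewrite mulrA expo_branch_survival// mulr_sumr; apply: eq_bigr => a _.
by rewrite -expRM_natl -expRD -natr1; congr expR; lra.
Qed.

Lemma expo_tail_sum_cvg b y : 0 < b ->
  \sum_(a < M) expR (- (b * (a.+1%:R - y))) @[M --> \oo] --> expo_branch b y.
Proof.
move=> b0; rewrite -[X in _ --> X]mulr1 -[X in _ * X]subr0.
rewrite (eq_cvg _ _ (fun M => expo_tail_sum y M b0)).
apply: cvgM (cvg_cst _) _; apply: cvgB (cvg_cst _) _.
by apply: cvg_expr; rewrite ger0_norm ?expR_ge0// expR_lt1 oppr_lt0.
Qed.

Lemma expo_tail_sum_gt b y x : 0 < b -> x < expo_branch b y ->
  exists M, x < \sum_(a < M) expR (- (b * (a.+1%:R - y))).
Proof.
move=> b0 x_lt; have := cvgr_gt _ (@expo_tail_sum_cvg b y b0) _ x_lt.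
by move=> /(_ _)/filter_ex.
Qed.

Lemma expo_branch_lt_left b y x : 0 < b -> expo_branch b y < x ->
  exists b', [/\ 0 < b', b' < b & expo_branch b' y < x].
Proof.
move=> b0 x_gt; have branch_cvg := @expo_branch_cvg R b y b0.
have : \forall b' \near b^'-, [/\ 0 < b', b' < b & expo_branch b' y < x].
  near=> b'; split; near: b'; [exact: nbhs_left_gt|exact: nbhs_left_lt|].
  by apply: (cvgr_lt _ (cvg_at_left_filter branch_cvg)).
by move=> /filter_ex.
Unshelve. all: by end_near.
Qed.

Lemma expo_branch_gap b b' : 0 < b -> b < b' ->
  exists2 eps : R, 0 < eps & forall y h, y <= 1 -> h <= eps ->
    (1 + eps) * expo_branch b' (y + h) < expo_branch b y.
Proof.
move=> b0 bb'; have b'0 : 0 < b' by exact: lt_trans bb'.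
have [c /andP[c0 c1] ratio] := expo_branch_ratio b0 bb'.
have [eps eps0] := expRM_small_lt (1 + b') c1; rewrite mulrDr mulr1 expRD => eps_lt1.
exists eps => // y h y1 h_eps; have branch0 := expo_branch_gt0 y b0.
apply: (@le_lt_trans _ _ (expR eps * expR (eps * b') * c * expo_branch b y)); last first.
  by rewrite gtr_pMl.
rewrite -!mulrA; apply: ler_pM; first by rewrite addr_ge0// ltW.
- exact/ltW/expo_branch_gt0.
- exact: expR_ge1Dx.
rewrite expo_branchD; apply: ler_pM; rewrite ?expR_ge0//.
- exact/ltW/expo_branch_gt0.
- by rewrite ler_expR mulrC ler_wpM2r// ltW.
- exact: ratio.
Qed.

Lemma exists_invn_le eps : 0 < eps -> exists2 N, (0 < N)%N & N%:R^-1 <= eps.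
Proof.
by move=> eps0; exists (Num.truncn eps^-1).+1 => //;
  rewrite invf_ple ?posrE// ltW// truncnS_gt.
Qed.

Lemma expo_branch_grid_lt b b' : 0 < b' -> b' < b ->
  exists s N, [/\ 0 < s < 1, (0 < N)%N & forall i, (i < N)%N ->
    expo_branch (s * b) (i.+1%:R / N%:R) < s * expo_branch b' (i%:R / N%:R)].
Proof.
move=> b'0 b'b; have b0 : 0 < b by exact: lt_trans b'b.
pose b1 := (b' + b) / 2; have b'b1 : b' < b1 by rewrite /b1; lra.
have b1b : b1 / b < 1 by rewrite ltr_pdivrMr// mul1r /b1; lra.
have [eps eps0 gap] := expo_branch_gap b'0 b'b1.
have [N N0 Neps] := exists_invn_le eps0.
have eps10 : 0 < 1 + eps by rewrite addr_gt0.
pose m := Num.max (b1 / b) (1 + eps)^-1.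
have m1 : m < 1 by rewrite gt_max b1b invf_lt1// ltrDl.
have m0 : 0 < m by rewrite lt_max invr_gt0 eps10 orbT.
have [m_b1 m_eps] : b1 / b <= m /\ (1 + eps)^-1 <= m by rewrite !le_max !lexx orbT.
exists ((m + 1) / 2), N; split=> // [|i iN]; first by apply/andP; split; lra.
set s := (m + 1) / 2; have ms : m <= s by rewrite /s; lra.
have b1_le : b1 <= s * b by rewrite -ler_pdivrMr//; exact: le_trans ms.
have eps_s : (1 + eps)^-1 <= s by exact: le_trans ms.
have NR0 : (0 : R) < N%:R by rewrite ltr0n.
apply: (@le_lt_trans _ _ (expo_branch b1 (i.+1%:R / N%:R))).
  apply: expo_branch_antitone => //; first exact: lt_trans b'b1.
  by rewrite divr_ge0//= ler_pdivrMr// mul1r ler_nat.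
apply: (@lt_le_trans _ _ ((1 + eps)^-1 * expo_branch b' (i%:R / N%:R))).
  rewrite ltr_pdivlMl//.
  rewrite -natr1 [(_ + 1) / _]mulrDl mul1r; apply: gap => //.
  by rewrite ler_pdivrMr// mul1r ler_nat ltnW.
by rewrite ler_pM2r// expo_branch_gt0.
Qed.

Lemma expo_branch_grid_gt b b' : 0 < b -> b < b' ->
  exists s N, [/\ 1 < s, (0 < N)%N & forall i, (i < N)%N ->
    s * expo_branch b' (i.+1%:R / N%:R) < expo_branch (s * b) (i%:R / N%:R)].
Proof.
move=> b0 bb'; have b'0 : 0 < b' by exact: lt_trans bb'.
pose b1 := (b + b') / 2; have b1b' : b1 < b' by rewrite /b1; lra.
have b10 : 0 < b1 by rewrite /b1; lra.
have bb1 : 1 < b1 / b by rewrite ltr_pdivlMr// mul1r /b1; lra.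
have [eps eps0 gap] := expo_branch_gap b10 b1b'.
have [N N0 Neps] := exists_invn_le eps0.
pose s := Num.min (b1 / b) (1 + eps).
have s1 : 1 < s by rewrite lt_min bb1 ltrDl.
have [s_b1 s_eps] : s <= b1 / b /\ s <= 1 + eps by rewrite !ge_min !lexx orbT.
exists s, N; split=> // i iN.
have NR0 : (0 : R) < N%:R by rewrite ltr0n.
have i1 : i%:R / N%:R <= 1 :> R by rewrite ler_pdivrMr// mul1r ler_nat ltnW.
apply: (@le_lt_trans _ _ ((1 + eps) * expo_branch b' (i.+1%:R / N%:R))).
  by rewrite ler_pM2r// expo_branch_gt0.
apply: (@lt_le_trans _ _ (expo_branch b1 (i%:R / N%:R))).
  by rewrite -natr1 [(_ + 1) / _]mulrDl mul1r; exact: gap.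
apply: expo_branch_antitone; first by rewrite mulr_gt0// (lt_trans ltr01).
  by rewrite -ler_pdivlMr.
by rewrite divr_ge0.
Qed.

End BranchComparison.

Section GridBounds.
Context {R : realType} {V : finType}.
Variables (e : rel V) (sigma : V -> R) (F : R -> R) (D : R) (N : nat).
Hypotheses (sigma0 : forall v, 0 <= sigma v) (liftF : circle_lift F) (D0 : 0 < D)
  (N0 : (0 < N)%N).

Lemma grid_cell (r : R) : 0 <= r < 1 ->
  exists2 i, (i < N)%N & i%:R / N%:R <= r <= i.+1%:R / N%:R.
Proof.
move=> /andP[r0 r1]; have NR0 : (0 : R) < N%:R by rewrite ltr0n.
have rN0 : 0 <= r * N%:R by rewrite mulr_ge0.
have /andP[i_le i_gt] := truncn_itv rN0.
exists (Num.truncn (r * N%:R)); first by rewrite truncn_lt_nat// gtr_pMl.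
by rewrite ler_pdivrMr// ler_pdivlMr// i_le ltW.
Qed.

Lemma firing_average_le_grid : (forall v, D <= (degree e v)%:R) ->
  (forall i v, (i < N)%N ->
    (\sum_(w | e v w) Num.truncn (sigma w / D + i.+1%:R / N%:R))%:R <=
    D * F (i%:R / N%:R)) ->
  forall v r, 0 <= r < 1 -> firing_average e sigma v r <= F r.
Proof.
move=> D_le grid v r r01; have /andP[r0 _] := r01.
have [i iN /andP[ir ri]] := grid_cell r01.
have deg0 w : (0 : R) < (degree e w)%:R by exact: lt_le_trans (D_le w).
rewrite /firing_average /neighbour_average -natr_sum ler_pdivrMr//.
apply: (@le_trans _ _ (D * F (i%:R / N%:R))); last first.
  rewrite mulrC; apply: ler_pM => //; first by rewrite circle_lift_ge0// divr_ge0.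
    exact: ltW.
  by case: liftF => _ + _; apply; rewrite ?divr_ge0.
apply: le_trans (grid i v iN); rewrite ler_nat; apply: leq_sum => w _.
by apply/le_truncn/lerD => //; rewrite ler_wpM2l// lef_pV2 ?posrE.
Qed.

Lemma firing_average_ge_grid : no_isolated e -> (forall v, (degree e v)%:R <= D) ->
  (forall i v, (i < N)%N -> D * F (i.+1%:R / N%:R) <=
    (\sum_(w | e v w) Num.truncn (sigma w / D + i%:R / N%:R))%:R) ->
  forall v r, 0 <= r < 1 -> F r <= firing_average e sigma v r.
Proof.
move=> iso le_D grid v r r01; have /andP[r0 _] := r01.
have [i iN /andP[ir ri]] := grid_cell r01.
have deg0 w : (0 : R) < (degree e w)%:R by rewrite ltr0n.
rewrite /firing_average /neighbour_average -natr_sum ler_pdivlMr//.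
apply: (@le_trans _ _ (D * F (i.+1%:R / N%:R))).
  rewrite mulrC; apply: ler_pM => //; first exact: circle_lift_ge0.
  by case: liftF => _ + _; apply.
apply: (le_trans (grid i v iN)); rewrite ler_nat; apply: leq_sum => w _.
by apply/le_truncn/lerD => //; rewrite ler_wpM2l// lef_pV2 ?posrE.
Qed.

End GridBounds.

(** * Geometric chips *)

Section NatCeil.
Context {R : realType}.
Implicit Types x y : R.

Definition natceil x : nat := `|Num.ceil x|%N.

Lemma natceil_le x m : 0 <= x -> (natceil x <= m)%N = (x <= m%:R).
Proof.
move=> x0; have c0 : (0 <= Num.ceil x)%R by rewrite ceil_ge0 (lt_le_trans _ x0)// ltrN10.
by rewrite pmulrn -ceil_le_int -lez_nat /natceil gez0_abs.
Qed.

Lemma natceil_ge x : 0 <= x -> x <= (natceil x)%:R.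
Proof. by move=> x0; rewrite -natceil_le. Qed.

Lemma natceil_leD1 x : 0 <= x -> (natceil x)%:R <= x + 1.
Proof.
move=> x0; apply: (@le_trans _ _ (Num.truncn x).+1%:R).
  by rewrite ler_nat natceil_le// ltW// truncnS_gt.
by rewrite -natr1 lerD2r truncn_le.
Qed.

Lemma natceil_homo x y : 0 <= x -> x <= y -> (natceil x <= natceil y)%N.
Proof.
by move=> x0 xy; rewrite natceil_le// (le_trans xy)// natceil_ge// (le_trans x0).
Qed.

(* The least number of chips [X] with [floor (X / D + r) > a]. *)
Definition chip_level (r D : R) (a : nat) : nat := natceil ((a.+1%:R - r) * D).

Lemma chip_level_arg_ge0 (r D : R) a : r <= 1 -> 0 <= D -> 0 <= (a.+1%:R - r) * D.
Proof. by move=> r1 D0; rewrite mulr_ge0// subr_ge0 (le_trans r1)// ler1n. Qed.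

Lemma chip_level_homo (r D : R) : r <= 1 -> 0 <= D ->
  {homo chip_level r D : a a' / (a <= a')%N}.
Proof.
move=> r1 D0 a a' aa'; apply: natceil_homo; first exact: chip_level_arg_ge0.
by rewrite ler_wpM2r// lerD2r ler_nat.
Qed.

Lemma chip_level_le (r D : R) a X : r <= 1 -> 0 < D ->
  (chip_level r D a <= X)%N = (a < Num.truncn (X%:R / D + r))%N.
Proof.
move=> r1 D0; rewrite truncn_gt_nat -lerBlDr ler_pdivlMr// natceil_le//.
exact/chip_level_arg_ge0/ltW.
Qed.

End NatCeil.

Section GeometricChips.
Context {R : realType}.
Implicit Types (mu : R) (u : nat -> R).

(* For such a sequence, [geometric_chips] does not take its default value. *)
Definition good_uniforms u : Prop :=
  (forall k, u k \in `[0, 1]) /\ (forall eps, 0 < eps -> exists k, u k <= eps).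

Definition chips_threshold n mu : R := (1 + mu * n%:R)^-1.

Lemma chips_threshold_gt0 n mu : 0 <= mu -> 0 < chips_threshold n mu.
Proof. by move=> mu0; rewrite invr_gt0 ltr_pwDl// mulr_ge0. Qed.

Lemma chips_threshold_itv n mu : 0 <= mu -> 0 <= chips_threshold n mu <= 1.
Proof.
move=> mu0; rewrite ltW ?chips_threshold_gt0//=.
by rewrite invf_le1 ?ltr_pwDl ?lerDl ?mulr_ge0.
Qed.

Lemma geometric_chips_gt n mu u k :
  (k < geometric_chips n mu u)%N -> u k \in `]chips_threshold n mu, 1].
Proof. by rewrite /geometric_chips; case: xgetP => [x _ [+ _]|//]; apply. Qed.

Lemma leq_geometric_chips n mu u j : good_uniforms u -> 0 <= mu ->
  (j <= geometric_chips n mu u)%N <->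
  (forall k, (k < j)%N -> u k \in `]chips_threshold n mu, 1]).
Proof.
move=> [u01 u_small] mu0; split=> [jle k kj|uj].
  by apply: geometric_chips_gt; exact: leq_trans kj jle.
rewrite leqNgt; apply/negP.
rewrite /geometric_chips; case: xgetP => [x _ [_ ux] xj|none _].
  move: (uj _ xj) ux; rewrite !in_itv /= => /andP[ux_gt _] /andP[_].
  by rewrite leNgt ux_gt.
have small_ex : exists k, u k <= chips_threshold n mu by exact/u_small/chips_threshold_gt0.
case: (ex_minnP small_ex) => k uk kmin; apply: (none k); split=> [i ik|].
  have := u01 i; rewrite !in_itv /= => /andP[_ ->]; rewrite andbT ltNge.
  by apply/negP => /kmin; rewrite leqNgt ik.
by have := u01 k; rewrite !in_itv /= => /andP[-> _].
Qed.

Lemma geometric_chips_homo n mu mu' u : good_uniforms u -> 0 <= mu ->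
  mu <= mu' -> (geometric_chips n mu u <= geometric_chips n mu' u)%N.
Proof.
move=> gu mu0 le_mu; have mu'0 : 0 <= mu' by exact: le_trans le_mu.
apply/(leq_geometric_chips _ _ gu mu'0) => k /geometric_chips_gt.
rewrite !in_itv /= => /andP[u_gt ->]; rewrite andbT; apply: le_lt_trans u_gt.
by rewrite lef_pV2 ?posrE ?ltr_pwDl ?mulr_ge0// lerD2l ler_wpM2r.
Qed.

Lemma geometric_chips0 n u : geometric_chips n 0 u = 0%N.
Proof.
apply/eqP; rewrite -leqn0 leqNgt; apply/negP => /geometric_chips_gt.
rewrite in_itv /= /chips_threshold mul0r addr0 invr1 => /andP[/lt_le_trans u1 /u1].
by rewrite ltxx.
Qed.

Lemma cvg_chips_threshold mu : 0 < mu ->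
  chips_threshold n mu * n%:R @[n --> \oo] --> mu^-1.
Proof.
move=> mu0.
have inv_cvg : (mu + n%:R^-1)^-1 @[n --> \oo] --> mu^-1.
  apply: cvgV; first by rewrite gt_eqF.
  rewrite -[X in _ --> X]addr0; apply: cvgD; first exact: cvg_cst.
  apply/gtr0_cvgV0; last exact: cvgr_idn.
  by near=> n; rewrite ltr0n; near: n; exact: nbhs_infty_gt.
apply: cvg_trans inv_cvg; apply: near_eq_cvg; near=> n.
have n0 : (0 : R) < n%:R by near: n; exact: nbhs_infty_gtr.
rewrite /chips_threshold -[X in _ * X]invrK -invfM mulrDl mul1r mulfK ?gt_eqF//.
by rewrite addrC.
Unshelve. all: by end_near.
Qed.

Lemma expr_survival_le n mu r D b a : 0 <= mu -> r <= 1 -> 0 <= D ->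
  b <= chips_threshold n mu * D ->
  (1 - chips_threshold n mu) ^+ chip_level r D a <=
    expR (- (b * (1 - r))) * expR (- b) ^+ a.
Proof.
move=> mu0 r1 D0; set t := chips_threshold n mu => bD.
have /andP[t0 t1] := chips_threshold_itv n mu0.
apply: (@le_trans _ _ (expR (- t) ^+ chip_level r D a)).
  by rewrite lerXn2r ?nnegrE ?expR_ge0 ?subr_ge0//; exact: expR_ge1Dx.
rewrite -!expRM_natl -expRD ler_expR.
have ar : 0 <= a.+1%:R - r by rewrite subr_ge0 (le_trans r1)// ler1n.
have := ler_wpM2l ar bD.
have := ler_wpM2l t0 (natceil_ge (chip_level_arg_ge0 a r1 D0)).
rewrite -/(chip_level r D a) -/t -natr1; lra.
Qed.

Lemma expr_survival_ge n mu r D b a : 0 < mu -> (0 < n)%N -> r <= 1 -> 0 <= D ->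
  D <= b * (mu * n%:R) ->
  expR (- (mu * n%:R)^-1) * expR (- (b * (a.+1%:R - r))) <=
    (1 - chips_threshold n mu) ^+ chip_level r D a.
Proof.
move=> mu0 n0 r1 D0; rewrite /chips_threshold; set z := mu * n%:R => Db.
have z0 : 0 < z by rewrite mulr_gt0// ltr0n.
have zi0 : 0 < z^-1 by rewrite invr_gt0.
have survival : expR (- z^-1) <= 1 - (1 + z)^-1.
  have z1 : 1 + z != 0 by rewrite gt_eqF// addr_gt0.
  have -> : 1 - (1 + z)^-1 = (1 + z^-1)^-1.
    rewrite -[X in X - _](divff z1) -[X in _ - X]mul1r -mulrBl addrAC subrr add0r.
    by rewrite -[LHS]invf_div mulrDl mul1r divff ?(gt_eqF z0)// addrC.
  by rewrite expRN lef_pV2 ?posrE ?expR_gt0 ?addr_gt0// expR_ge1Dx.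
apply: (@le_trans _ _ (expR (- z^-1) ^+ chip_level r D a)); last first.
  by rewrite lerXn2r ?nnegrE ?expR_ge0// (le_trans _ survival)// expR_ge0.
rewrite -expRM_natl -expRD ler_expR.
have ar : 0 <= a.+1%:R - r by rewrite subr_ge0 (le_trans r1)// ler1n.
have arDb : (a.+1%:R - r) * D / z <= (a.+1%:R - r) * b.
  by rewrite ler_pdivrMr// -mulrA ler_wpM2l.
have := ler_wpM2r (ltW zi0) (natceil_leD1 (chip_level_arg_ge0 a r1 D0)).
rewrite -/(chip_level r D a) mulrDl mul1r; lra.
Qed.

End GeometricChips.

(** * Random graphs with geometric chips *)

Section FiniteFamilies.

Lemma uniq_flatten_map (I T : eqType) (F : I -> seq T) (s : seq I) : uniq s ->
  {in s, forall i, uniq (F i)} ->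
  {in s &, forall i i' x, x \in F i -> x \in F i' -> i = i'} ->
  uniq (flatten (map F s)).
Proof.
elim: s => //= i s IH /andP[i_notin s_uniq] F_uniq F_disj.
have s_sub i' : i' \in s -> i' \in i :: s by rewrite in_cons orbC => ->.
rewrite cat_uniq F_uniq ?mem_head//= IH//.
- rewrite andbT; apply/hasPn => x /flatten_mapP[i' i's xi']; apply/negP => /= xi.
  by move: i_notin; rewrite (F_disj i i' (mem_head _ _) (s_sub _ i's) x xi xi') i's.
- by move=> i' /s_sub; exact: F_uniq.
- by move=> i' i'' /s_sub i's /s_sub i''s; exact: F_disj.
Qed.

Lemma bigcap_flatten_map (I T : eqType) (Omega : Type) (F : I -> seq T)
    (B : T -> set Omega) (s : seq I) :
  \bigcap_(x in [set` flatten (map F s)]) B x =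
  \bigcap_(i in [set` s]) \bigcap_(x in [set` F i]) B x.
Proof.
apply/seteqP; split=> w Bw.
- by move=> i /= si x /= xi; apply: Bw => /=; apply/flatten_mapP; exists i.
- by move=> x /= /flatten_mapP[i si xi]; exact: (Bw i si x xi).
Qed.

Lemma expr_size_flatten_map {R : pzSemiRingType} (I T : Type) (F : I -> seq T)
    (s : seq I) (c : R) :
  c ^+ size (flatten (map F s)) = \prod_(i <- s) c ^+ size (F i).
Proof. by rewrite prodrXr size_flatten /shape -map_comp sumnE big_map. Qed.

Lemma prode_cst {R : realType} (I : eqType) (s : seq I) (f : I -> \bar R) (c : R) :
  {in s, forall i, f i = c%:E} -> (\prod_(i <- s) f i)%E = (c ^+ size s)%:E.
Proof.
move=> f_cst; rewrite (eq_big_seq _ f_cst) prodEFin.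
by rewrite big_const_seq count_predT iter_mulr_1.
Qed.

Lemma sum_ltn_minn M X : (\sum_(a < M) (a < X) = minn M X)%N.
Proof.
elim: M => [|M IH]; first by rewrite big_ord0 min0n.
by rewrite big_ord_recr /= IH; case: (ltnP M X); lia.
Qed.

Lemma sum_minn_lt {R : numDomainType} (I : finType) (Q : pred I) (X : I -> nat) (M : nat)
    (x : R) :
  (\sum_(i | Q i) minn M (X i))%:R < x -> x <= M%:R -> (\sum_(i | Q i) X i)%:R < x.
Proof.
move=> sum_lt xM; suff <- : (\sum_(i | Q i) minn M (X i) = \sum_(i | Q i) X i)%N by [].
apply: eq_bigr => i Qi; rewrite (minn_idPr _)// leqNgt; apply/negP => MX.
have := lt_le_trans sum_lt xM; rewrite ltr_nat ltnNge => /negP; apply.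
by rewrite (bigD1 i)//= (minn_idPl (ltnW MX)) leq_addr.
Qed.

Lemma card_pair_complement n (u v : 'I_n) :
  (#|[pred i | (i != u) && (i != v)]| <= n <= #|[pred i | (i != u) && (i != v)]| + 2)%N.
Proof.
have := cardC [pred i | (i != u) && (i != v)]; rewrite card_ord => card_eq.
rewrite -[X in (_ <= X <= _)%N]card_eq leq_addr leq_add2l; apply: (@leq_trans #|pred2 u v|).
  by apply: subset_leq_card; apply/fintype.subsetP => i; rewrite !inE negb_and !negbK.
by rewrite card2; case: (_ != _).
Qed.

End FiniteFamilies.

Section UniformVariables.
Context {R : realType}.

Lemma uniform_prob_gt (t : R) : 0 <= t <= 1 ->
  uniform_prob (@ltr01 R) `]t, 1]%classic = (1 - t)%:E.
Proof.
move=> /andP[t0 t1]; rewrite /uniform_prob integral_uniform_pdf.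
have sub01 x : t < x <= 1 -> 0 <= x <= 1.
  by move=> /andP[tx ->]; rewrite andbT (le_trans t0)// ltW.
have -> : `]t, 1]%classic `&` `[0, 1]%classic = `]t, 1]%classic.
  by apply/setIidPl => x; rewrite /= !in_itv; exact: sub01.
rewrite (eq_integral (fun=> 1%:E)) => [|x]; last first.
  by rewrite inE /= in_itv /= => /sub01 x01; rewrite /uniform_pdf x01 subr0 invr1.
rewrite integral_cst//= lebesgue_measure_itv /= lte_fin mul1e.
have [//|t_ge1] := ltP t 1; have -> : t = 1 by apply/le_anti; rewrite t1.
by rewrite subrr.
Qed.

Lemma uniform_prob_unit : uniform_prob (@ltr01 R) `[0, 1]%classic = 1%E.
Proof. exact: integral_uniform_pdf1. Qed.

End UniformVariables.

Section RandomModel.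
Context {R : realType} {d : measure_display} {Omega : measurableType d}
  (P : probability Omega R).
Variables (p : R) (G : forall n : nat, Omega -> rel 'I_n)
  (U : forall n : nat, 'I_n -> nat -> {RV P >-> R}).
Arguments G : clear implicits.
Hypotheses (p01 : 0 < p <= 1) (erG : forall n : nat, erdos_renyi P p (G n))
  (uniU : forall (n : nat) (v : 'I_n) (k : nat), uniform01 (U v k))
  (indGU : mutually_independent P (source_events G U)).

Let p0 : 0 < p. Proof. by case/andP : p01. Qed.

Lemma graph_sym n w : symmetric (G n w).
Proof. by case: (erG n) => /(_ w)[]. Qed.

Lemma graph_irr n w : irreflexive (G n w).
Proof. by case: (erG n) => /(_ w)[]. Qed.

Definition ordered n (e : 'I_n * 'I_n) : bool := (e.1 < e.2)%N.

Definition ordered_pair n (v w : 'I_n) := if (v < w)%N then (v, w) else (w, v).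

Lemma ordered_ordered_pair n (v w : 'I_n) : v != w -> ordered (ordered_pair v w).
Proof.
by rewrite /ordered /ordered_pair; have [| |/val_inj ->] := ltngtP v w; rewrite ?eqxx.
Qed.

Lemma graph_ordered_pair n w (u v : 'I_n) :
  G n w (ordered_pair u v).1 (ordered_pair u v).2 = G n w u v.
Proof. by rewrite /ordered_pair; case: ifP => //= _; rewrite graph_sym. Qed.

Lemma ordered_pair_inj n (a b u v : 'I_n) : ordered_pair a b = ordered_pair u v ->
  (a = u /\ b = v) \/ (a = v /\ b = u).
Proof.
rewrite /ordered_pair; do 2 case: ifP => _; case=> -> ->; by [left|right].
Qed.

Definition edges_event n (L : seq ('I_n * 'I_n)) : set Omega :=
  \bigcap_(e in [set` L]) [set w | G n w e.1 e.2].

Definition uniforms_event n (K : seq ('I_n * nat)) (t : R) : set Omega :=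
  \bigcap_(x in [set` K]) (U x.1 x.2 @^-1` `]t, 1]%classic).

Lemma measurable_edges_event n (L : seq ('I_n * 'I_n)) :
  all (@ordered n) L -> measurable (edges_event L).
Proof.
move=> /allP L_ord; have [_ edge _] := erG n.
apply: fin_bigcap_measurable => [|e /L_ord e_ord]; first exact: finite_seq.
exact: (edge _ _ e_ord).1.
Qed.

Lemma measurable_uniforms_event n (K : seq ('I_n * nat)) t :
  measurable (uniforms_event K t).
Proof.
apply: fin_bigcap_measurable => [|x _]; first exact: finite_seq.
by rewrite -[X in measurable X]setTI; exact: measurable_funPT.
Qed.

Lemma edges_event_prob n (L : seq ('I_n * 'I_n)) : uniq L -> all (@ordered n) L ->
  P (edges_event L) = (p ^+ size L)%:E.
Proof.
move=> L_uniq L_ord; have [_ edge ind] := erG n.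
pose s : seq {e : 'I_n * 'I_n | (e.1 < e.2)%N} := pmap insub L.
have -> : edges_event L = \bigcap_(e in [set` s]) [set w | G n w (val e).1 (val e).2].
  apply/seteqP; split=> w Lw e /=; first by rewrite mem_pmap_sub => /Lw.
  move=> eL; have e_ord := allP L_ord _ eL.
  by apply: (Lw (Sub e e_ord)); rewrite /= mem_pmap_sub.
rewrite ind//; last exact: pmap_sub_uniq.
rewrite (prode_cst (c := p)); last by move=> e _; exact: (edge _ _ (valP e)).2.
by rewrite size_pmap_sub; move: L_ord; rewrite all_count => /eqP ->.
Qed.

Lemma uniform_gt_prob n (v : 'I_n) k (t : R) : 0 <= t <= 1 ->
  P (U v k @^-1` `]t, 1]%classic) = (1 - t)%:E.
Proof. by move=> t01; rewrite -uniform_prob_gt// -(uniU v k). Qed.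

Lemma sources_prob n (L : seq ('I_n * 'I_n)) (K : seq ('I_n * nat)) (t : R) :
  uniq L -> all (@ordered n) L -> uniq K -> 0 <= t <= 1 ->
  P (edges_event L `&` uniforms_event K t) = (p ^+ size L * (1 - t) ^+ size K)%:E.
Proof.
move=> L_uniq L_ord K_uniq t01.
pose idx (x : 'I_n * nat) : nat + {n : nat & ('I_n * nat)%type} :=
  inr (existT (fun n => ('I_n * nat)%type) n x).
have idx_inj : injective idx.
  by move=> x y [] /eqP; rewrite eq_Tagged => /eqP.
pose A (i : nat + {n : nat & ('I_n * nat)%type}) : set Omega :=
  match i with
  | inl _ => edges_event L
  | inr (existT m (v, k)) => U v k @^-1` `]t, 1]%classic
  end.
have -> : edges_event L `&` uniforms_event K t =
    \bigcap_(i in [set` inl n :: map idx K]) A i.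
  apply/seteqP; split=> w.
    move=> [wL wK] i /=; rewrite in_cons => /predU1P[->//|/mapP[[v k] xK ->]].
    exact: wK xK.
  move=> Aw; split; first by apply: (Aw (inl n)); rewrite /= mem_head.
  by move=> [v k] xK; apply: (Aw (idx (v, k))); rewrite /= in_cons map_f ?orbT.
rewrite indGU.
- rewrite big_cons /= edges_event_prob// big_map EFinM; congr (_ * _)%E.
  by apply: prode_cst => -[v k] _; exact: uniform_gt_prob.
- by rewrite /= map_inj_uniq// K_uniq andbT; apply/negP => /mapP[].
- move=> i; rewrite in_cons => /predU1P[->|/mapP[[v k] xK ->]] /=.
    by exists [set r : rel 'I_n | forall e, e \in L -> r e.1 e.2].
  by exists `]t, 1]%classic.
Qed.

Definition pair_edges n (u v i : 'I_n) := undup [:: ordered_pair u i; ordered_pair v i].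

Definition first_uniforms n (i : 'I_n) m := [seq (i, k) | k <- iota 0 m].

(* The case [u = v] counts chips on the neighbours of one vertex; [u != v] serves to
   find common neighbours. *)
Definition neighbour_event n (u v : 'I_n) (j : nat -> nat) (t : R) (i : 'I_n) (a : nat) :
    set Omega :=
  edges_event (pair_edges u v i) `&` uniforms_event (first_uniforms i (j a)) t.

Lemma neighbour_eventP n (u v : 'I_n) j t i a w : neighbour_event u v j t i a w <->
  [/\ G n w u i, G n w v i & forall k, (k < j a)%N -> U i k w \in `]t, 1]].
Proof.
split=> [[edges unifs]|[ui vi unifs]].
  split=> [| |k kj].
  - by rewrite -graph_ordered_pair; apply: edges; rewrite /= mem_undup mem_head.
  - by rewrite -graph_ordered_pair; apply: edges; rewrite /= mem_undup !inE eqxx orbT.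
  - by apply: (unifs (i, k)); apply: map_f; rewrite mem_iota.
split=> [e|[i' k] /mapP[x + [-> ->]]].
  by rewrite /= mem_undup !inE => /orP[] /eqP ->; rewrite graph_ordered_pair.
by rewrite mem_iota => xj; exact: unifs.
Qed.

Definition level_edges n (u v i : 'I_n) (k : nat) :=
  if k is _.+1 then pair_edges u v i else [::].

Definition level_uniforms n (j : nat -> nat) (i : 'I_n) (k : nat) :=
  if k is a.+1 then first_uniforms i (j a) else [::].

Lemma level_neighbour_event n (u v : 'I_n) j t i k :
  level (neighbour_event u v j t i) k =
  edges_event (level_edges u v i k) `&` uniforms_event (level_uniforms j i k) t.
Proof.
case: k => //=; rewrite /edges_event /uniforms_event.
by rewrite (_ : [set` [::]] = set0) ?bigcap_set0 ?setTI//; apply/seteqP; split.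
Qed.

Lemma mem_level_edges n (u v i : 'I_n) k e : e \in level_edges u v i k ->
  e = ordered_pair u i \/ e = ordered_pair v i.
Proof. by case: k => // k; rewrite mem_undup !inE => /orP[] /eqP ->; [left|right]. Qed.

Lemma uniq_level_edges n (u v i : 'I_n) k : uniq (level_edges u v i k).
Proof. by case: k => // k; exact: undup_uniq. Qed.

Lemma uniq_level_uniforms n j (i : 'I_n) k : uniq (level_uniforms j i k).
Proof. by case: k => // a; rewrite map_inj_uniq ?iota_uniq// => x y []. Qed.

Lemma ordered_level_edges n (u v i : 'I_n) k : (i != u) && (i != v) ->
  all (@ordered n) (level_edges u v i k).
Proof.
move=> /andP[iu iv]; apply/allP => e.
by move=> /mem_level_edges[] ->; apply: ordered_ordered_pair; rewrite eq_sym.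
Qed.

Lemma size_pair_edges n (u v i : 'I_n) : i != u ->
  size (pair_edges u v i) = (1 + (u != v))%N.
Proof.
move=> iu; rewrite /pair_edges /= inE.
have -> : (ordered_pair u i == ordered_pair v i) = (u == v).
  apply/eqP/eqP => [/ordered_pair_inj[[]//|[ui _]]|->//].
  by move: iu; rewrite ui eqxx.
by case: (u == v).
Qed.

Lemma measurable_level_neighbour_event n (u v : 'I_n) j t i k :
  (i != u) && (i != v) -> measurable (level (neighbour_event u v j t i) k).
Proof.
move=> Qi; rewrite level_neighbour_event.
apply: measurableI; last exact: measurable_uniforms_event.
exact/measurable_edges_event/ordered_level_edges.
Qed.

Lemma neighbour_event_prob n (u v : 'I_n) j t i a : (i != u) && (i != v) ->
  0 <= t <= 1 ->
  P (neighbour_event u v j t i a) = (p ^+ (1 + (u != v)) * (1 - t) ^+ j a)%:E.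
Proof.
move=> Qi t01; have /andP[iu _] := Qi.
rewrite sources_prob//.
- by rewrite size_pair_edges// size_map size_iota.
- exact: undup_uniq.
- exact: (ordered_level_edges 1 Qi).
- exact: (uniq_level_uniforms j i a.+1).
Qed.

Lemma neighbour_event_independent n (u v : 'I_n) j t (f : 'I_n -> nat) : 0 <= t <= 1 ->
  fine (P (\bigcap_(i in [set i | (i != u) && (i != v)])
    level (neighbour_event u v j t i) (f i))) =
  \prod_(i | (i != u) && (i != v)) fine (P (level (neighbour_event u v j t i) (f i))).
Proof.
move=> t01; pose Q i := (i != u) && (i != v); pose s := enum Q.
have sQ i : i \in s -> Q i by rewrite mem_enum.
have -> : [set i | Q i] = [set` s] by apply/seteqP; split=> i /=; rewrite mem_enum.
under eq_bigcapr do rewrite level_neighbour_event.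
rewrite bigcapI -!(bigcap_flatten_map (fun i => _)).
rewrite -/(edges_event _) -/(uniforms_event _ _) sources_prob//.
- rewrite /= !expr_size_flatten_map -big_split /= big_enum /=.
  apply: eq_bigr => i Qi; rewrite level_neighbour_event sources_prob//.
  + exact: uniq_level_edges.
  + exact: ordered_level_edges.
  + exact: uniq_level_uniforms.
- apply: uniq_flatten_map => [|i _|i i' /sQ/andP[iu iv] /sQ/andP[iu' iv'] x].
  + exact: enum_uniq.
  + exact: uniq_level_edges.
  + by move=> /mem_level_edges[] -> /mem_level_edges[] /ordered_pair_inj[[//]|[a b]];
      move: iu iv iu' iv'; rewrite ?a ?b ?eqxx.
- apply/allP => x /flatten_mapP[i /sQ Qi].
  exact/allP/ordered_level_edges.
- apply: uniq_flatten_map => [|i _|i i' _ _ x].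
  + exact: enum_uniq.
  + exact: uniq_level_uniforms.
  + by case: (f i) => // a; case: (f i') => // a' /mapP[? _ ->] /mapP[? _ [->]].
Qed.

Definition neighbour_count n (u v : 'I_n) j t M w : R :=
  \sum_(i | (i != u) && (i != v)) \sum_(a < M) \1_(neighbour_event u v j t i a) w.

Lemma measurable_neighbour_count_ge n (u v : 'I_n) j t M theta S :
  measurable [set w | theta * S <= theta * neighbour_count u v j t M w].
Proof.
apply: measurable_level_sum_ge => i a Qi.
exact: (measurable_level_neighbour_event j t a.+1 Qi).
Qed.

Lemma neighbour_count_chernoff n (u v : 'I_n) j t M theta S :
  {homo j : a a' / (a <= a')%N} -> 0 <= t <= 1 ->
  (P [set w | (theta * S <= theta * neighbour_count u v j t M w)%R] <=
    (expR (- (theta * S)) *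
     tail_mgf theta M (fun a => p ^+ (1 + (u != v)) * (1 - t) ^+ j a) ^+
       #|[pred i | (i != u) && (i != v)]|)%:E)%E.
Proof.
move=> j_homo t01.
have := @level_chernoff R d Omega P _ (fun i => (i != u) && (i != v))
  (neighbour_event u v j t) M theta S.
move=> /(_ _ _ (fun f => neighbour_event_independent u v j f t01)) /le_trans; apply.
- by move=> i a; exact: (measurable_level_neighbour_event j t a.+1).
- move=> i a _ w /neighbour_eventP[ui vi unifs]; apply/neighbour_eventP; split=> // k kj.
  by apply: unifs; apply: leq_trans kj (j_homo _ _ _).
rewrite lee_fin ler_wpM2l ?expR_ge0// -prodr_const le_eqVlt; apply/predU1P; left.
apply: eq_bigr => i Qi; congr (_ + _); apply: eq_bigr => a _; congr (_ * _).
by rewrite neighbour_event_prob.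
Qed.

Lemma neighbour_prob_itv (t : R) a k : 0 <= t <= 1 -> 0 <= p ^+ a * (1 - t) ^+ k <= 1.
Proof.
move=> /andP[t0 t1]; have /andP[_ p1] := p01.
have s0 : 0 <= 1 - t by rewrite subr_ge0.
have s1 : 1 - t <= 1 by rewrite lerBlDr lerDl.
by rewrite mulr_ge0 ?mulr_ile1 ?exprn_ge0 ?exprn_ile1 ?(ltW p0).
Qed.

Lemma ae_neighbour_count_deviation (b : bool) (j : nat -> nat -> nat) (t : nat -> R)
    (M : nat -> nat) (theta x x' : R) :
  (forall n, {homo j n : a a' / (a <= a')%N}) -> (forall n, 0 <= t n <= 1) ->
  0 < theta * (x - x') ->
  (\forall n \near \oo, tail_mgf theta (M n)
    (fun a => p ^+ (1 + b) * (1 - t n) ^+ j n a) <= expR (theta * x')) ->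
  {ae P, forall w, \forall n \near \oo, forall u v : 'I_n, (u != v) = b ->
    theta * neighbour_count u v (j n) (t n) (M n) w < theta * (x * n%:R)}.
Proof.
move=> j_homo t01 xx' mgf_le.
pose E n (e : 'I_n * 'I_n) := if (e.1 != e.2) == b
  then [set w | theta * (x * n%:R) <= theta * neighbour_count e.1 e.2 (j n) (t n) (M n) w]
  else set0.
have mE n e : measurable (@E n e).
  by rewrite /E; case: ifP => // _; exact: measurable_neighbour_count_ge.
pose C := expR (2 * `|theta * x'|); pose k := expR (- (theta * (x - x'))).
have PE : \forall n \near \oo, forall e : 'I_n * 'I_n, (P (E n e) <= (C * k ^+ n)%:E)%E.
  apply: filterS mgf_le => n mgf_le e; rewrite /E; case: ifP => [/eqP eb|_]; last first.
    by rewrite measure0 lee_fin mulr_ge0 ?exprn_ge0 ?expR_ge0.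
  apply: le_trans (neighbour_count_chernoff _ _ _ _ _ (j_homo n) (t01 n)) _.
  rewrite lee_fin eb; apply: chernoff_rate => //; last exact: card_pair_complement.
  by apply: tail_mgf_ge0 => a; exact: neighbour_prob_itv.
have k01 : 0 < k < 1 by rewrite expR_gt0 expR_lt1 oppr_lt0.
have mU n : measurable (\bigcup_e E n e).
  by apply: fin_bigcup_measurable => //; exact: finite_finset.
have PU : \forall n \near \oo, (P (\bigcup_e E n e) <= (C * n%:R ^+ 2 * k ^+ n)%:E)%E.
  apply: filterS PE => n PE; apply: le_trans (probability_bigcup_le (mE n) PE) _.
  by rewrite lee_fin card_prod card_ord mulrA natrM -expr2 (mulrC _ C).
apply: filterS (borel_cantelli_exponential k01 mU PU) => w.
apply: filterS => n notE u v uv; rewrite ltNge; apply/negP => count_ge.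
by apply: notE; exists (u, v) => //; rewrite /E /= uv eqxx.
Qed.

Lemma ae_neighbour_count_lt (b : bool) (j : nat -> nat -> nat) (t : nat -> R)
    (M : nat -> nat) (c q x : R) :
  (forall n, {homo j n : a a' / (a <= a')%N}) -> (forall n, 0 <= t n <= 1) ->
  0 <= c -> 0 <= q < 1 -> c < x * (1 - q) ->
  (\forall n \near \oo, forall a, p ^+ (1 + b) * (1 - t n) ^+ j n a <= c * q ^+ a) ->
  {ae P, forall w, \forall n \near \oo, forall u v : 'I_n, (u != v) = b ->
    neighbour_count u v (j n) (t n) (M n) w < x * n%:R}.
Proof.
move=> j_homo t01 c0 q01 cx tail_le.
have [theta [x' [theta0 x'x mgf_le]]] := tail_mgf_upper c0 q01 cx.
have : {ae P, forall w, \forall n \near \oo, forall u v : 'I_n, (u != v) = b ->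
    theta * neighbour_count u v (j n) (t n) (M n) w < theta * (x * n%:R)}.
  apply: (ae_neighbour_count_deviation (x' := x')) => //.
    by rewrite mulr_gt0// subr_gt0.
  by apply: filterS tail_le => n; exact: mgf_le.
apply: filterS => w; apply: filterS => n count_lt u v uv.
by have := count_lt u v uv; rewrite ltr_pM2l.
Qed.

Lemma ae_neighbour_count_gt (b : bool) (j : nat -> nat -> nat) (t : nat -> R) M
    (f0 : nat -> R) (x : R) :
  (forall n, {homo j n : a a' / (a <= a')%N}) -> (forall n, 0 <= t n <= 1) ->
  (forall a, 0 <= f0 a) -> x < \sum_(a < M) f0 a ->
  (\forall n \near \oo, forall a, f0 a <= p ^+ (1 + b) * (1 - t n) ^+ j n a) ->
  {ae P, forall w, \forall n \near \oo, forall u v : 'I_n, (u != v) = b ->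
    x * n%:R < neighbour_count u v (j n) (t n) M w}.
Proof.
move=> j_homo t01 f00 xf tail_ge.
have [theta [x' [theta0 xx' mgf_le]]] := tail_mgf_lower f00 xf.
have : {ae P, forall w, \forall n \near \oo, forall u v : 'I_n, (u != v) = b ->
    theta * neighbour_count u v (j n) (t n) M w < theta * (x * n%:R)}.
  apply: (ae_neighbour_count_deviation (M := fun=> M) (x' := x')) => //.
    by rewrite nmulr_rgt0// subr_lt0.
  by apply: filterS tail_ge => n; exact: mgf_le.
apply: filterS => w; apply: filterS => n count_gt u v uv.
by have := count_gt u v uv; rewrite ltr_nM2l.
Qed.

Lemma neighbour_count_edges n (u v : 'I_n) j t w : j 0 = 0%N ->
  neighbour_count u v j t 1 w = #|[pred i | G n w u i && G n w v i]|%:R.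
Proof.
move=> j0; rewrite /neighbour_count -sum1_card natr_sum big_mkcond [RHS]big_mkcond /=.
apply: eq_bigr => i _; rewrite big_ord1 inE /=.
have [uvi|nuvi] := boolP (G n w u i && G n w v i).
  have /andP[ui vi] := uvi.
  have -> : i != u by apply/eqP => iu; move: ui; rewrite iu graph_irr.
  have -> : i != v by apply/eqP => iv; move: vi; rewrite iv graph_irr.
  by rewrite indicE mem_set//; apply/neighbour_eventP; split=> // k; rewrite j0.
case: ifP => // _; rewrite indicE memNset// => /neighbour_eventP[ui vi _].
by move: nuvi; rewrite ui vi.
Qed.

Lemma neighbour_count_degree n (v : 'I_n) j t w : j 0 = 0%N ->
  neighbour_count v v j t 1 w = (degree (G n w) v)%:R.
Proof.
move=> /neighbour_count_edges ->; congr (_%:R); apply: eq_card => i.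
by rewrite !inE andbb.
Qed.

Lemma ae_degree_lt (x : R) : p < x ->
  {ae P, forall w, \forall n \near \oo, forall v : 'I_n,
    (degree (G n w) v)%:R < x * n%:R}.
Proof.
move=> px.
have : {ae P, forall w, \forall n \near \oo, forall u v : 'I_n, (u != v) = false ->
    neighbour_count u v id 1 1 w < x * n%:R}.
  apply: (ae_neighbour_count_lt (b := false) (j := fun=> id) (t := fun=> 1)
    (c := p) (q := 0) (fun=> 1%N)) => //.
  - by move=> _ a a'.
  - by move=> _; rewrite ler01 lexx.
  - exact: ltW.
  - by rewrite lexx ltr01.
  - by rewrite subr0 mulr1.
  - by apply: nearW => n a; rewrite expr1 subrr.
apply: filterS => w; apply: filterS => n count_lt v.
by rewrite -(@neighbour_count_degree n v id 1)// count_lt// eqxx.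
Qed.

Lemma ae_degree_gt (x : R) : x < p ->
  {ae P, forall w, \forall n \near \oo, forall v : 'I_n,
    x * n%:R < (degree (G n w) v)%:R}.
Proof.
move=> xp.
have : {ae P, forall w, \forall n \near \oo, forall u v : 'I_n, (u != v) = false ->
    x * n%:R < neighbour_count u v (fun=> 0%N) 0 1 w}.
  apply: (ae_neighbour_count_gt (b := false) (j := fun _ _ => 0%N) (t := fun=> 0)
    (f0 := fun=> p)) => //.
  - by move=> _; rewrite lexx ler01.
  - by move=> _; exact: ltW.
  - by rewrite big_ord1.
  - by apply: nearW => n a; rewrite expr1 expr0 mulr1.
apply: filterS => w; apply: filterS => n count_gt v.
by rewrite -(@neighbour_count_degree n v (fun=> 0%N) 0)// count_gt// eqxx.
Qed.

Lemma ae_common_neighbours :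
  {ae P, forall w, \forall n \near \oo, common_neighbours (G n w)}.
Proof.
have : {ae P, forall w, \forall n \near \oo, forall u v : 'I_n, (u != v) = true ->
    0 * n%:R < neighbour_count u v (fun=> 0%N) 0 1 w}.
  apply: (ae_neighbour_count_gt (b := true) (j := fun _ _ => 0%N) (t := fun=> 0)
    (f0 := fun=> p ^+ 2)) => //.
  - by move=> _; rewrite lexx ler01.
  - by move=> _; exact: sqr_ge0.
  - by rewrite big_ord1 exprn_gt0.
  - by apply: nearW => n a; rewrite expr0 mulr1.
apply: filterS => w; apply: filterS => n count_gt u v uv; have := count_gt u v uv.
by rewrite mul0r neighbour_count_edges// ltr0n => /card_gt0P[i]; exists i.
Qed.

Definition well_connected n (e : rel 'I_n) :=
  [/\ (0 < n)%N, common_neighbours e & no_isolated e].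

Lemma ae_well_connected :
  {ae P, forall w, \forall n \near \oo, well_connected (G n w)}.
Proof.
apply: filterS2 ae_common_neighbours (ae_degree_gt p0) => w.
apply: filterS3 (nbhs_infty_gt 0) => n n0 cn deg; split=> // v.
by rewrite -(ltr0n R) -[ltLHS](mul0r n%:R).
Qed.

Definition chips n (mu : R) w : 'I_n -> R := chip_configuration mu (fun v k => U v k w).

Lemma neighbour_count_chips n (v : 'I_n) mu r D M w :
  (forall v : 'I_n, good_uniforms (fun k => U v k w)) ->
  0 <= mu -> r <= 1 -> 0 < D ->
  neighbour_count v v (chip_level r D) (chips_threshold n mu) M w =
  (\sum_(i | G n w v i) minn M (Num.truncn (chips mu w i / D + r)))%:R.
Proof.
move=> gU mu0 r1 D0; rewrite /neighbour_count natr_sum big_mkcond [RHS]big_mkcond /=.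
apply: eq_bigr => i _; rewrite andbb; have [vi|nvi] := boolP (G n w v i); last first.
  case: ifP => // _; rewrite big1// => a _; rewrite indicE memNset//.
  by move=> /neighbour_eventP[]; rewrite (negbTE nvi).
have -> : i != v by apply/eqP => iv; move: vi; rewrite iv graph_irr.
rewrite -sum_ltn_minn natr_sum; apply: eq_bigr => a _; rewrite indicE; congr (_ %:R).
congr nat_of_bool; rewrite -chip_level_le//; apply/idP/idP => [|level_le].
  by rewrite inE => /neighbour_eventP[_ _] /(leq_geometric_chips _ _ (gU i) mu0).
rewrite inE; apply/neighbour_eventP; split=> //.
exact/(leq_geometric_chips _ _ (gU i) mu0).
Qed.

Lemma ae_uniform_unit n (v : 'I_n) k : {ae P, forall w, U v k w \in `[0, 1]}.
Proof.
have m01 : measurable (U v k @^-1` `[0, 1]%classic).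
  by rewrite -[X in measurable X]setTI; exact: measurable_funPT.
exists (~` (U v k @^-1` `[0, 1]%classic)); split; first exact: measurableC.
  rewrite probability_setC// (_ : P _ = 1%E) ?subee//.
  by rewrite -uniform_prob_unit -(uniU v k).
by move=> w /= not_unit /not_unit.
Qed.

Lemma ae_uniform_small n (v : 'I_n) (eps : R) : 0 < eps <= 1 ->
  {ae P, forall w, exists k, U v k w \notin `]eps, 1]}.
Proof.
move=> /andP[eps0 eps1]; have eps01 : 0 <= eps <= 1 by rewrite ltW.
pose B m := uniforms_event (first_uniforms v m) eps.
have mB m : measurable (B m) by exact: measurable_uniforms_event.
have PB m : P (B m) = ((1 - eps) ^+ m)%:E.
  have := @sources_prob n [::] (first_uniforms v m) eps isT isT.
  rewrite /edges_event (_ : [set` [::]] = set0); last by apply/seteqP; split.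
  rewrite bigcap_set0 setTI expr0 mul1r size_map size_iota; apply=> //.
  exact: (uniq_level_uniforms id v m.+1).
exists (\bigcap_m B m); split; first exact: bigcapT_measurable.
  apply/eqP; rewrite eq_le measure_ge0 andbT.
  have mI : measurable (\bigcap_m B m) by exact: bigcapT_measurable.
  have P_le m : (P (\bigcap_m B m) <= ((1 - eps) ^+ m)%:E)%E.
    by rewrite -PB; apply: le_measure; rewrite ?inE//; exact: bigcap_inf.
  have P_fin : P (\bigcap_m B m) \is a fin_num by exact: fin_num_measure.
  rewrite -(fineK P_fin) lee_fin.
  have pow_cvg : (1 - eps) ^+ m @[m --> \oo] --> (0 : R).
    by apply: cvg_expr; rewrite ger0_norm; lra.
  by apply: (cvgr_to_ge pow_cvg); apply: nearW => m; rewrite -lee_fin fineK.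
move=> w /= never_small m _ x /mapP[k _ ->] /=.
by apply: contrapT => small; apply: never_small; exists k; apply/negP.
Qed.

Lemma ae_good_uniforms :
  {ae P, forall w, forall n (v : 'I_n), good_uniforms (fun k => U v k w)}.
Proof.
apply: ae_foralln => n; apply: (ae_forall_countable (T := 'I_n)) => v.
have unit : {ae P, forall w, forall k, U v k w \in `[0, 1]}.
  by apply: ae_foralln => k; exact: ae_uniform_unit.
have small : {ae P, forall w, forall m, exists k, U v k w \notin `](m.+1%:R^-1), 1]}.
  apply: ae_foralln => m; apply: ae_uniform_small.
  by rewrite invr_gt0 ltr0n /= invf_le1 ?ler1n.
apply: filterS2 unit small => w unit small; split=> // eps eps0.
have [k] := small (Num.truncn eps^-1); have := unit k.
rewrite !in_itv /= => /andP[_ ->]; rewrite andbT -leNgt => Uk; exists k.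
by apply: le_trans Uk _; rewrite invf_ple ?posrE// ltW// truncnS_gt.
Qed.

Lemma ae_neighbour_firings_lt mu r s (x : R) : 0 < mu -> r <= 1 -> 0 < s ->
  p * expo_branch (s / mu) r < x ->
  {ae P, forall w, \forall n \near \oo, forall v : 'I_n,
    (\sum_(i | G n w v i) Num.truncn (chips mu w i / (s * n%:R) + r))%:R < x * n%:R}.
Proof.
move=> mu0 r1 s0 branch_x; have smu0 : 0 < s / mu by rewrite divr_gt0.
have [b [b0 b_s b_x]] : exists b, [/\ 0 < b, b < s / mu & expo_branch b r < x / p].
  by apply: expo_branch_lt_left => //; rewrite ltr_pdivlMr// mulrC.
have q1 : expR (- b) < 1 by rewrite expR_lt1 oppr_lt0.
pose c := p * expR (- (b * (1 - r))).
have cx : c < x * (1 - expR (- b)).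
  rewrite /c -expo_branch_survival// mulrA ltr_pM2r ?subr_gt0//.
  by rewrite mulrC -ltr_pdivlMr.
have D0 n : 0 <= s * n%:R by rewrite mulr_ge0// ltW.
have tail_le : \forall n \near \oo, forall a, p ^+ (1 + false) *
    (1 - chips_threshold n mu) ^+ chip_level r (s * n%:R) a <= c * expR (- b) ^+ a.
  have bs_mu : b / s < mu^-1 by rewrite ltr_pdivrMr// mulrC.
  near=> n => a; rewrite expr1 -mulrA ler_pM2l//.
  apply: expr_survival_le => //; first exact: ltW.
  rewrite mulrCA mulrC -ler_pdivrMr// ltW//; near: n.
  exact: (cvgr_gt _ (cvg_chips_threshold mu0) _ bs_mu).
pose M n := (Num.truncn (x * n%:R)).+1.
have count_lt := ae_neighbour_count_lt M
  (fun n => chip_level_homo r1 (D0 n)) (fun n => chips_threshold_itv n (ltW mu0))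
  (mulr_ge0 (ltW p0) (expR_ge0 _)) (_ : 0 <= expR (- b) < 1) cx tail_le.
apply: filterS2 ae_good_uniforms (count_lt _) => [w gU|]; last by rewrite expR_ge0.
apply: filterS2 (nbhs_infty_gt 0) => n n0 count_lt' v.
apply: (@sum_minn_lt _ _ _ _ (M n)); last by rewrite ltW// truncnS_gt.
rewrite -neighbour_count_chips ?count_lt' ?eqxx ?(ltW mu0)//.
by rewrite mulr_gt0// ltr0n.
Unshelve. all: by end_near.
Qed.

Lemma ae_neighbour_firings_gt mu r s (x : R) : 0 < mu -> r <= 1 -> 0 < s ->
  x < p * expo_branch (s / mu) r ->
  {ae P, forall w, \forall n \near \oo, forall v : 'I_n,
    x * n%:R < (\sum_(i | G n w v i) Num.truncn (chips mu w i / (s * n%:R) + r))%:R}.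
Proof.
move=> mu0 r1 s0 x_branch; set b := s / mu; have b0 : 0 < b by rewrite divr_gt0.
pose tail (a : nat) : R := expR (- (b * (a.+1%:R - r))).
have [M xM] : exists M, x / p < \sum_(a < M) tail a.
  by apply: expo_tail_sum_gt => //; rewrite ltr_pdivrMr// mulrC.
have [theta theta0 x_theta] := expRM_small_gt (- 1) xM.
pose f0 a := p * (expR (theta * -1) * tail a).
have f00 a : 0 <= f0 a by rewrite !mulr_ge0 ?expR_ge0 ?(ltW p0).
have D0 n : 0 <= s * n%:R by rewrite mulr_ge0// ltW.
have tail_ge : \forall n \near \oo, forall a, f0 a <= p ^+ (1 + false) *
    (1 - chips_threshold n mu) ^+ chip_level r (s * n%:R) a.
  near=> n => a; have n0 : (0 < n)%N by near: n; exact: nbhs_infty_gt.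
  rewrite expr1 ler_pM2l//.
  apply: (le_trans _ (@expr_survival_ge _ n mu r (s * n%:R) b a mu0 n0 r1 (D0 n) _)).
    rewrite ler_wpM2r ?expR_ge0// ler_expR mulrN1 lerN2.
    rewrite invf_ple ?posrE ?mulr_gt0 ?ltr0n// -ler_pdivrMl//.
    by near: n; exact: nbhs_infty_ger.
  by rewrite mulrA divfK ?gt_eqF.
have x_f0 : x < \sum_(a < M) f0 a.
  by rewrite -!mulr_sumr mulrC -ltr_pdivrMr.
have count_gt := ae_neighbour_count_gt (fun n => chip_level_homo r1 (D0 n))
  (fun n => chips_threshold_itv n (ltW mu0)) f00 x_f0 tail_ge.
apply: filterS2 ae_good_uniforms count_gt => w gU.
apply: filterS2 (nbhs_infty_gt 0) => n n0 count_gt v.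
apply: (lt_le_trans (count_gt v v _)); first by rewrite eqxx.
rewrite neighbour_count_chips ?(ltW mu0)//; last by rewrite mulr_gt0// ltr0n.
by rewrite ler_nat; apply: leq_sum => i _; exact: geq_minr.
Unshelve. all: by end_near.
Qed.

Lemma ae_activity_le mu b : 0 < mu -> 0 < b < p / mu ->
  {ae P, forall w, \forall n \near \oo, activity (G n w) (chips mu w) <= expo_rotation b}.
Proof.
move=> mu0 /andP[b0 b_lt].
have [s [N [/andP[s0 s1] N0 grid]]] := expo_branch_grid_lt b0 b_lt.
have ps0 : 0 < p * s by rewrite mulr_gt0.
have psp : p * s < p by rewrite gtr_pMr.
have firings_lt : {ae P, forall w, forall i : 'I_N, \forall n \near \oo, forall v : 'I_n,
    (\sum_(k | G n w v k)
      Num.truncn (chips mu w k / (p * s * n%:R) + i.+1%:R / N%:R))%:R <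
    p * s * expo_branch b (i%:R / N%:R) * n%:R}.
  apply: (ae_forall_countable (T := 'I_N)) => i; apply: ae_neighbour_firings_lt => //.
    by rewrite ler_pdivrMr ?ltr0n// mul1r ler_nat.
  by rewrite (mulrAC p s mu^-1) (mulrC (p / mu)) -[ltRHS]mulrA ltr_pM2l// grid.
apply: filterS3 firings_lt ae_well_connected (ae_degree_gt psp) => w /filter_forall.
apply: filterS3 => n firings_lt [n0 cn iso] deg.
have lift_b := expo_map_lift b0.
apply: (activity_le_rotation (Ordinal n0)) => //; first exact: graph_sym.
apply: (@firing_average_le_grid _ _ _ _ _ (p * s * n%:R) N) => //.
- by rewrite mulr_gt0// ltr0n.
- by move=> v; exact: ltW.
- move=> i v iN; rewrite expo_map_branch//; last first.
    by rewrite divr_ge0//= ler_pdivrMr ?ltr0n// mul1r ler_nat ltnW.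
  by rewrite [leRHS]mulrAC; exact/ltW/(firings_lt (Ordinal iN)).
Qed.

Lemma ae_activity_ge mu b : 0 < mu -> p / mu < b ->
  {ae P, forall w, \forall n \near \oo, expo_rotation b <= activity (G n w) (chips mu w)}.
Proof.
move=> mu0 b_gt; have pmu0 : 0 < p / mu by rewrite divr_gt0.
have b0 : 0 < b by exact: lt_trans b_gt.
have [s [N [s1 N0 grid]]] := expo_branch_grid_gt pmu0 b_gt.
have s0 : 0 < s by exact: lt_trans s1.
have pps : p < p * s by rewrite ltr_pMr.
have firings_gt : {ae P, forall w, forall i : 'I_N, \forall n \near \oo, forall v : 'I_n,
    p * s * expo_branch b (i.+1%:R / N%:R) * n%:R <
    (\sum_(k | G n w v k) Num.truncn (chips mu w k / (p * s * n%:R) + i%:R / N%:R))%:R}.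
  apply: (ae_forall_countable (T := 'I_N)) => i; apply: ae_neighbour_firings_gt => //.
  - by rewrite ler_pdivrMr ?ltr0n// mul1r ler_nat ltnW.
  - by rewrite mulr_gt0.
  - by rewrite (mulrAC p s mu^-1) (mulrC (p / mu)) -[ltLHS]mulrA ltr_pM2l// grid.
apply: filterS3 firings_gt ae_well_connected (ae_degree_lt pps) => w /filter_forall.
apply: filterS3 => n firings_gt [n0 cn iso] deg.
have lift_b := expo_map_lift b0.
apply: (activity_ge_rotation (Ordinal n0)) => //; first exact: graph_sym.
apply: (@firing_average_ge_grid _ _ _ _ _ (p * s * n%:R) N) => //.
- by rewrite !mulr_gt0// ltr0n.
- by move=> v; exact: ltW.
- move=> i v iN; rewrite expo_map_branch//; last first.
    by rewrite divr_ge0//= ler_pdivrMr ?ltr0n// mul1r ler_nat.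
  by rewrite [leLHS]mulrAC; exact/ltW/(firings_gt (Ordinal iN)).
Qed.

Lemma ae_activity_cvg_at mu : 0 < mu ->
  {ae P, forall w, activity (G n w) (@chips n mu w) @[n --> \oo] --> limit_activity p mu}.
Proof.
move=> mu0; apply: ae_cvg => e e0; rewrite limit_activity_gt0//.
have pmu0 : 0 < p / mu by rewrite divr_gt0.
have /cvgrPdist_le/(_ _ e0) rot_close := expo_rotation_continuous pmu0.
have [b b_lt rot_b] : exists2 b, 0 < b < p / mu &
    `|expo_rotation (p / mu) - expo_rotation b| <= e.
  have : \forall b \near (p / mu)^'-, 0 < b < p / mu /\
      `|expo_rotation (p / mu) - expo_rotation b| <= e.
    near=> b; split; last by near: b; exact: (cvg_at_left_filter cvg_id).
    by apply/andP; split; near: b; [exact: nbhs_left_gt|exact: nbhs_left_lt].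
  by move=> /filter_ex[b [b_lt rot_b]]; exists b.
have [b' b'_gt rot_b'] : exists2 b', p / mu < b' &
    `|expo_rotation (p / mu) - expo_rotation b'| <= e.
  have : \forall b' \near (p / mu)^'+, p / mu < b' /\
      `|expo_rotation (p / mu) - expo_rotation b'| <= e.
    near=> b'; split; first by near: b'; exact: nbhs_right_gt.
    by near: b'; exact: (cvg_at_right_filter cvg_id).
  by move=> /filter_ex[b' [b'_gt rot_b']]; exists b'.
apply: filterS2 (ae_activity_le mu0 b_lt) (ae_activity_ge mu0 b'_gt) => w.
apply: filterS2 => n; move: rot_b rot_b'.
move: (expo_rotation _) (expo_rotation b) (expo_rotation b') (activity _ _).
by move=> rot rot_l rot_r act; rewrite !ler_norml; lra.
Unshelve. all: by end_near.
Qed.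

Lemma chips0 n w : @chips n 0 w = fun=> 0.
Proof. by apply/funext => v; rewrite /chips /chip_configuration geometric_chips0. Qed.

Lemma chips_homo n mu mu' w (v : 'I_n) :
  (forall v : 'I_n, good_uniforms (fun k => U v k w)) -> 0 <= mu -> mu <= mu' ->
  chips mu w v <= chips mu' w v.
Proof. by move=> gU mu0 le_mu; rewrite ler_nat; exact: geometric_chips_homo. Qed.

Lemma ae_activity_cvg : {ae P, forall w, forall mu : R, 0 <= mu ->
  activity (G n w) (@chips n mu w) @[n --> \oo] --> limit_activity p mu}.
Proof.
have rat_cvg : {ae P, forall w, forall q : rat, (0 : R) < ratr q ->
    activity (G n w) (@chips n (ratr q) w) @[n --> \oo] --> limit_activity p (ratr q)}.
  apply: (ae_forall_countable (T := rat)) => q.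
  have [q0|q0] := pselect (0 < ratr q :> R); last exact: aeW.
  by apply: filterS (ae_activity_cvg_at q0).
apply: filterS3 ae_good_uniforms ae_well_connected rat_cvg => w gU conn rat_cvg mu mu0.
apply: (homo_cvg_rat (f := fun n mu => activity (G n w) (@chips n mu w))) => //.
- apply: filterS conn => n [n0 cn iso] nu nu' nu0 le_nu.
  apply: (activity_homo (Ordinal n0) (@graph_sym n w)) => // v.
  exact: chips_homo.
- move=> q; rewrite le_eqVlt => /predU1P[<-|]; last exact: rat_cvg.
  rewrite /limit_activity lexx; apply: cvg_near_cst.
  apply: filterS conn => n [n0 cn iso].
  by rewrite chips0 (activity0 (Ordinal n0)).
- exact: limit_activity_continuous.
Qed.

End RandomModel.

Theorem theorem6p9 (R : realType) (d : measure_display)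
    (Omega : measurableType d) (P : probability Omega R) (p : R)
    (G : forall n : nat, Omega -> rel 'I_n)
    (U : forall n : nat, 'I_n -> nat -> {RV P >-> R})
    (hp : 0 < p <= 1)
    (hG : forall n : nat, erdos_renyi P p (G n))
    (hU : forall (n : nat) (v : 'I_n) (k : nat), uniform01 (U n v k))
    (hind : mutually_independent P (source_events G U)) :
  exists c : R -> R, devils_staircase 0 (p / ln 2) c /\
    {ae P, forall w : Omega, forall mu : R, mu \in `[0, p / ln 2] ->
      activity (G n w) (chip_configuration mu (fun v k => U n v k w))
        @[n --> \oo] --> c mu}.
Proof.
have /andP[p0 _] := hp.
exists (limit_activity p); split; first exact: limit_activity_staircase.
apply: filterS (ae_activity_cvg hp hG hU hind) => w act_cvg mu.
by rewrite in_itv /= => /andP[mu0 _]; exact: act_cvg.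
Qed.
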